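(* Let $P_1,\dots,P_n$ and $Q_1,\dots,Q_n$ be convex polytopes in $\mathbb R^n$ such that $P_i\subseteq Q_i$ for every $i\in\{1,\dots,n\}$. For $u\in\mathbb S^{n-1}$ let $$T_u=\{i\in\{1,\dots,n\}\ |\ P_i\cap Q_i^u\neq\emptyset\}.$$ Then $V(P_1,\dots,P_n)<V(Q_1,\dots,Q_n)$ if and only if there exists $u\in\mathbb S^{n-1}$ such that the collection $\{Q_i^u\ |\ i\in T_u\}\cup\{Q_i\ |\ i\in\{1,\dots,n\}\setminus T_u\}$ is essential.
   Context: $V(K_1,\dots,K_n)$ denotes the mixed volume of convex bodies in $\mathbb R^n$ (the coefficient of $\lambda_1\cdots\lambda_n$ in the polynomial $\operatorname{Vol}_n(\lambda_1K_1+\dots+\lambda_nK_n)$, $\lambda_i\ge0$). For a convex body $K$ and $u\in\mathbb R^n$, $h_K(u)=\max\{\langle u,x\rangle\mid x\in K\}$ is the support function and $K^u=\{x\in K\mid \langle u,x\rangle=h_K(u)\}$ is the face of $K$ with outer normal $u$. A collection (multiset) $\{K_1,\dots,K_m\}$ of convex bodies in $\mathbb R^n$ is essential if for every subset $I\subseteq\{1,\dots,m\}$ with $|I|\le n$ one has $\dim\sum_{i\in I}K_i\ge |I|$ (Minkowski sum). *)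

(* Defs.v *)
From HB Require Import structures.
From mathcomp Require Import all_boot all_order all_algebra.
From mathcomp Require Import all_classical all_reals.
From mathcomp Require Import ereal sequences.
Set Implicit Arguments. Unset Strict Implicit. Unset Printing Implicit Defensive.
Import Order.TTheory GRing.Theory Num.Theory.
Local Open Scope classical_set_scope.
Local Open Scope ring_scope.

Section ConvexGeometry.
Variables (R : realType) (n : nat).
Local Notation vec := 'rV[R]_n.

Definition inner (u x : vec) : R := \sum_(i < n) u 0 i * x 0 i.

Definition unit_sphere : set vec := [set u | inner u u = 1].

Definition conv (s : seq vec) : set vec :=
  [set x | exists w : 'I_(size s) -> R,
     [/\ (forall i, 0 <= w i), \sum_(i < size s) w i = 1 &
         x = \sum_(i < size s) w i *: s`_(val i)]].

Definition polytope (P : set vec) : Prop :=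
  exists s : seq vec, s != [::] /\ P = conv s.

Definition face (K : set vec) (u : vec) : set vec :=
  [set x | K x /\ forall y, K y -> inner u y <= inner u x].

Definition msum (I : {set 'I_n}) (K : 'I_n -> set vec) : set vec :=
  [set x | exists y : 'I_n -> vec,
     (forall i, i \in I -> K i (y i)) /\ x = \sum_(i in I) y i].

Definition dilate (l : R) (K : set vec) : set vec := [set l *: x | x in K].

(* dim S >= k  (dim = dimension of the affine hull):
   S contains k+1 affinely independent points x0, x0 + v_1, ..., x0 + v_k *)
Definition dim_ge (S : set vec) (k : nat) : Prop :=
  exists x0, S x0 /\ exists v : 'I_k -> vec,
    (forall i, S (x0 + v i)) /\ row_free (\matrix_(i < k) v i).

Definition essential (K : 'I_n -> set vec) : Prop :=
  forall I : {set 'I_n}, (#|I| <= n)%N -> dim_ge (msum I K) #|I|.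

Definition box (a b : vec) : set vec :=
  [set x | forall i : 'I_n, a 0 i <= x 0 i <= b 0 i].
Definition boxvol (a b : vec) : R := \prod_(i < n) Num.max (b 0 i - a 0 i) 0.
Definition volume (A : set vec) : \bar R :=
  ereal_inf [set s | exists a b : nat -> vec,
     A `<=` \bigcup_k box (a k) (b k) /\
     s = (\sum_(k <oo) (boxvol (a k) (b k))%:E)%E].

(* mixed volume V(K_1,...,K_n): the coefficient of l_1 * ... * l_n in the
   polynomial l |-> Vol(l_1 K_1 + ... + l_n K_n)  (l_i >= 0).
   Polynomials in l_1..l_n of degree <= n+1 in each variable are encoded by
   their coefficient function on exponent vectors al : 'I_n -> 'I_(n.+2).
   Such a representation on the orthant is unique, so the coefficient is
   well defined; xget picks it. *)
Definition exps := {ffun 'I_n -> 'I_n.+2}.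
Definition poly_eval (c : exps -> R) (l : 'I_n -> R) : R :=
  \sum_(al : exps) c al * \prod_(i < n) l i ^+ al i.
Definition ones_exp : exps := [ffun => inord 1].
Definition mixed_volume (K : 'I_n -> set vec) : R :=
  xget 0 [set v | exists c : exps -> R,
    (forall l : 'I_n -> R, (forall i, 0 <= l i) ->
       volume (msum [set: 'I_n] (fun i => dilate (l i) (K i)))
       = (poly_eval c l)%:E)
    /\ v = c ones_exp].

Definition Tu (P Q : 'I_n -> set vec) (u : vec) : {set 'I_n} :=
  [set i | `[< P i `&` face (Q i) u !=set0 >]].
End ConvexGeometry.

(* Main.v *)
Require Import Defs.
From HB Require Import structures.
From mathcomp Require Import all_boot all_order all_algebra.
From mathcomp Require Import all_classical all_reals.
From mathcomp Require Import ereal sequences esum numfun measure measurable_realfun.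
From mathcomp Require Import lebesgue_measure lebesgue_integral.
From mathcomp Require Import ring lra zify.
Set Implicit Arguments. Unset Strict Implicit. Unset Printing Implicit Defensive.
Import Order.TTheory GRing.Theory Num.Theory.
Local Open Scope classical_set_scope.
Local Open Scope ring_scope.

(* Encode a family of polytopes as a finite set of coloured points and lift the
   points to arbitrary heights. The upper faces of the lifted family cut every
   weighted Minkowski sum into cells, indexed by vectors w, that overlap in
   hyperplanes only; hence the mixed volume is the sum of the mixed volumes of the
   cells. Iterating this until all cells are products of simplices shows that the
   volume is a polynomial in the weights and that the mixed volume is nonnegative,
   positive exactly when the polytopes contain segments with linearly independent
   directions.
   Lift the vertices of P_i to height 0 and the remaining vertices of Q_i to -1:
   the cell of w = 0 is the family P, so V(P) < V(Q) iff some cell w <> 0 contains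
   independent segments; for i in T_u with u = w/|w|, the i-th part of this cell
   lies in Q_i^u, so the family of the theorem is essential.
   Conversely, Rado's theorem turns essentiality into independent segments
   [a_i, b_i], with a_i in Q_i^u and b_i close to a_i. Adding those with i in T_u to
   P and lifting the others just enough to reach the hyperplane supporting P_i in
   direction u makes them a cell, at w = u, different from the cell of w = 0. *)

(** * Volume *)

(** [volume] is a bare infimum over box covers, so the first task is to make it an outer measure for
    which polytopes are measurable and hyperplanes are null. After that only the sign of mixed
    volumes matters: a linear map enters through the existence of a positive scaling factor. Cells
    of a family of polytopes are again such families, but the iteration also needs a size that
    decreases. This is why bodies are replaced by subsets of a fixed finite index set: a proper cell
    is a smaller subset. Extracting the coefficient by interpolation writes the mixed volume as a
    fixed linear combination of volumes. Additivity over cells is thereby inherited from the volume,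
    and monotonicity follows since cells contribute nonnegatively. In the converse, the ends [b_i]
    are moved towards [a_i] because at full length they might drop to or below the hyperplane
    supporting [P_i]; shrinking keeps the directions independent. *)

Section VolumeOuterMeasure.
Variable R : realType.

Lemma boxvol_ge0 (n : nat) (a b : 'rV[R]_n) : 0 <= boxvol a b.
Proof. by apply: prodr_ge0 => i _; rewrite le_max lexx orbT. Qed.

Lemma volume_ge0 (n : nat) (A : set 'rV[R]_n) : (0 <= volume A)%E.
Proof.
apply: le_ereal_inf_tmp => _ [a [b [_ ->]]].
by apply: nneseries_ge0 => k _ _; rewrite lee_fin boxvol_ge0.
Qed.

Lemma volume_cover (n : nat) (A : set 'rV[R]_n) (a b : nat -> 'rV[R]_n) :
  A `<=` \bigcup_k box (a k) (b k) ->
  (volume A <= \sum_(k <oo) (boxvol (a k) (b k))%:E)%E.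
Proof. by move=> Aab; apply: ereal_inf_lbound; exists a, b. Qed.

Lemma le_volume (n : nat) (A B : set 'rV[R]_n) :
  A `<=` B -> (volume A <= volume B)%E.
Proof.
move=> AB; apply: le_ereal_inf_tmp => _ [a [b [Bab ->]]].
by apply: volume_cover; apply: subset_trans Bab.
Qed.

Lemma volume_sigma_subadditive (n : nat) :
  sigma_subadditive (@volume R n).
Proof.
move=> A.
have [[i Aioo]|Afin] := pselect (exists i, volume (A i) = +oo%E).
  rewrite (eseries_pinfty _ _ Aioo) ?leey// => k _.
  by rewrite gt_eqF// (lt_le_trans _ (volume_ge0 _)).
apply/lee_addgt0Pr => e e0.
apply: le_trans (epsilon_trick xpredT (fun k => volume_ge0 (A k)) (ltW e0)).
have cov k : exists ab : (nat -> 'rV[R]_n) * (nat -> 'rV[R]_n),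
    A k `<=` \bigcup_j box (ab.1 j) (ab.2 j) /\
    (\sum_(j <oo) (boxvol (ab.1 j) (ab.2 j))%:E <=
       volume (A k) + (e / (2 ^ k.+1)%:R)%:E)%E.
  have ek : 0 < e / (2 ^ k.+1)%:R by rewrite divr_gt0// ltr0n expn_gt0.
  have Akfin : volume (A k) \is a fin_num.
    rewrite ge0_fin_numE ?volume_ge0// ltey; apply/eqP => Akoo.
    by apply: Afin; exists k.
  have [_ [a [b [Aab ->]]] /ltW lt_ab] := lb_ereal_inf_adherent ek Akfin.
  by exists (a, b).
have [ab abP] := choice cov.
pose a2 (x : nat * nat) := (ab x.1).1 x.2; pose b2 (x : nat * nat) := (ab x.1).2 x.2.
(* A single sequence of boxes has to list the doubly indexed covers. *)
have /card_esym/ppcard_eqP[f] := card_nat2.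
pose v (x : nat * nat) : \bar R := (boxvol (a2 x) (b2 x))%:E.
have v0 x : (0 <= v x)%E by rewrite lee_fin boxvol_ge0.
have -> // : (volume (\bigcup_k A k) <=
    \sum_(k <oo) \sum_(j <oo) v (k, j) ->
  volume (\bigcup_k A k) <=
    \sum_(k <oo) (volume (A k) + (e / (2 ^ k.+1)%:R)%:E))%E.
  move=> /le_trans; apply; apply: lee_nneseries => [k _ _|k _].
    exact: nneseries_ge0.
  exact: (abP k).2.
have -> : (\sum_(k <oo) \sum_(j <oo) v (k, j) = \sum_(i <oo) v (f i))%E.
  rewrite [RHS]nneseries_esumT// -(reindex_esum setT setT f)//.
  rewrite nneseries_esumT; last by move=> k; exact: nneseries_ge0.
  under eq_esum do rewrite nneseries_esumT//.
  rewrite esum_esum// (_ : _ `*`` _ = setT); last first.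
    by apply/seteqP; split.
  by apply: eq_esum => -[].
apply: volume_cover => x [k _ /(abP k).1 [j _ xj]].
by exists (f^-1%FUN (k, j)) => //; rewrite /= invK ?inE.
Qed.

(** Positive dimension makes the box with both corners at 0 have volume 0; in dimension 0 every box
    has volume 1, an empty product. *)
Lemma volume_set0 (n' : nat) : volume (set0 : set 'rV[R]_n'.+1) = 0%E.
Proof.
apply/eqP; rewrite eq_le volume_ge0 andbT.
apply: le_trans (@volume_cover _ set0 (fun=> 0) (fun=> 0) _) _ => //.
rewrite eseries0// => k _ _.
by rewrite /boxvol big_ord_recl !mxE subrr maxxx mul0r.
Qed.

HB.instance Definition _ (n' : nat) := isOuterMeasure.Build R 'rV[R]_n'.+1
  (@volume R n'.+1) (@volume_set0 n') (@volume_ge0 _) (@le_volume _)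
  (@volume_sigma_subadditive _).

Lemma volume_box_le (n' : nat) (a b : 'rV[R]_n'.+1) :
  (volume (box a b) <= (boxvol a b)%:E)%E.
Proof.
apply: le_trans (@volume_cover _ _ (fun k => if k is 0%N then a else 0)
  (fun k => if k is 0%N then b else 0) _) _.
  by move=> x xab; exists 0%N.
rewrite nneseries_recl//; last by move=> k _; rewrite lee_fin boxvol_ge0.
rewrite eseries0 ?adde0// => -[//|k] _ _.
by rewrite /boxvol big_ord_recl !mxE subrr maxxx mul0r.
Qed.

(** The images of a box cover of [A] cover the image of [A], so a bound on boxes passes to arbitrary
    sets; positivity of [c] allows dividing by it before taking the infimum. *)
Lemma volume_image_le (n' : nat) (phi : 'rV[R]_n'.+1 -> 'rV[R]_n'.+1) (c : R) :
  0 < c -> (forall a b, (volume (phi @` box a b) <= (c * boxvol a b)%:E)%E) ->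
  forall A, (volume (phi @` A) <= c%:E * volume A)%E.
Proof.
move=> c0 phic A; rewrite -lee_pdivrMl//.
apply: le_ereal_inf_tmp => _ [a [b [Aab ->]]].
rewrite lee_pdivrMl//.
rewrite -nneseriesZl; last by move=> k _; rewrite lee_fin boxvol_ge0.
have sub : phi @` A `<=` \bigcup_k (phi @` box (a k) (b k)).
  by move=> _ [x Ax <-]; have [k _ xk] := Aab _ Ax; exists k => //; exists x.
apply: le_trans (le_volume sub) _.
apply: le_trans (volume_sigma_subadditive _) _.
apply: lee_nneseries => k; first by move=> _ _; exact: volume_ge0.
by rewrite -EFinM.
Qed.

Lemma volume_translate (n' : nat) (v : 'rV[R]_n'.+1) (A : set 'rV[R]_n'.+1) :
  volume [set v + x | x in A] = volume A.
Proof.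
have le (w : 'rV[R]_n'.+1) B : (volume [set w + x | x in B]%R <= volume B)%E.
  rewrite -[leRHS]mul1e; apply: volume_image_le => // a b.
  rewrite mul1r (_ : boxvol a b = boxvol (w + a) (w + b)); last first.
    by apply: eq_bigr => i _; rewrite !mxE opprD addrACA subrr add0r.
  apply: le_trans (volume_box_le _ _); apply: le_volume => _ [x xab <-] i.
  by rewrite !mxE !lerD2l.
apply/eqP; rewrite eq_le le /=.
rewrite {1}(_ : A = [set - v + x | x in [set v + x | x in A]]) ?le//.
apply/seteqP; split=> [x Ax|_ [_ [x Ax <-] <-]].
  by exists (v + x); [exists x|rewrite addKr].
by rewrite addKr.
Qed.

Definition rescale (n : nat) (d : 'I_n -> R) (x : 'rV[R]_n) : 'rV[R]_n :=
  \row_i (d i * x 0 i).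

Lemma volume_rescale (n' : nat) (d : 'I_n'.+1 -> R) (A : set 'rV[R]_n'.+1) :
  (forall i, 0 < d i) ->
  volume (rescale d @` A) = ((\prod_i d i)%:E * volume A)%E.
Proof.
move=> d0.
have le (f : 'I_n'.+1 -> R) B : (forall i, 0 < f i) ->
    (volume (rescale f @` B) <= (\prod_i f i)%:E * volume B)%E.
  move=> f0; apply: volume_image_le => [|a b]; first exact: prodr_gt0.
  rewrite (_ : _ * _ = boxvol (rescale f a) (rescale f b)); last first.
    rewrite /boxvol -big_split; apply: eq_bigr => i _.
    by rewrite /= !mxE -mulrBr maxr_pMr ?mulr0// ltW.
  apply: le_trans (volume_box_le _ _); apply: le_volume => _ [x xab <-] i.
  by rewrite !mxE !ler_pM2l.
apply/eqP; rewrite eq_le le//=.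
rewrite -lee_pdivlMl ?prodr_gt0// -prodfV.
apply: le_trans (le _ _ _) => [|i]; last by rewrite invr_gt0.
apply: le_volume => x Ax; exists (rescale d x); first by exists x.
by apply/rowP => i; rewrite !mxE mulKf ?gt_eqF.
Qed.

End VolumeOuterMeasure.

(** * The volume of a box *)

Section BoxLower.
Variable R : realType.

Lemma lebesgue_measure_segment (a b : R) :
  lebesgue_measure (`[a, b]%classic : set R) = (Num.max (b - a) 0)%:E.
Proof.
rewrite lebesgue_measure_itv/= lte_fin; case: ltP => ab.
  by rewrite -EFinB max_l// subr_ge0 ltW.
by rewrite max_r// subr_le0.
Qed.

(* The sum is restricted to a set of indices so that it can be sliced: the
   boxes that miss the slice have to be dropped, and in dimension 0 no box
   has volume 0. *)
Lemma boxvol_le_cover (n : nat) (a b : 'rV[R]_n) (aa bb : nat -> 'rV[R]_n)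
    (D : pred nat) :
  box a b `<=` \bigcup_(k in [set` D]) box (aa k) (bb k) ->
  ((boxvol a b)%:E <= \sum_(k <oo) ((D k)%:R * boxvol (aa k) (bb k))%:E)%E.
Proof.
elim: n => [|n IHn] in a b aa bb D *.
  move=> /(_ 0)[|k Dk _]; first by case.
  have t0 j : (0 <= ((D j)%:R * boxvol (aa j) (bb j))%:E)%E.
    by rewrite lee_fin mulr_ge0// boxvol_ge0.
  rewrite (@nneseriesD1 _ _ k)// [in X in (_ <= X + _)%E](_ : D k = true)//.
  rewrite mul1r /boxvol !big_ord0 leeDl//.
  by apply: nneseries_ge0 => j _ _; exact: t0.
move=> cov.
pose tl (x : 'rV[R]_n.+1) : 'rV[R]_n := \row_j x 0 (lift ord0 j).
have boxvolS x y : boxvol x y =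
    boxvol (tl x) (tl y) * Num.max (y 0 ord0 - x 0 ord0) 0.
  rewrite /boxvol big_ord_recl mulrC; congr (_ * _).
  by apply: eq_bigr => i _; rewrite !mxE.
pose I (x y : 'rV[R]_n.+1) : set R := `[x 0 ord0, y 0 ord0]%classic.
pose v k := (D k)%:R * boxvol (tl (aa k)) (tl (bb k)).
have v0 k : 0 <= v k by rewrite mulr_ge0// boxvol_ge0.
(* [f k x] is the weighted volume of the slice of the [k]-th box at first coordinate [x].
   Integrating the induction hypothesis for the slices over [x], and exchanging sum and integral,
   gives the claim. *)
pose f k (x : R) : \bar R := (v k * \1_(I (aa k) (bb k)) x)%:E.
have f0 k x : (0 <= f k x)%E by rewrite lee_fin mulr_ge0.
have mI x y : measurable (I x y) by exact: measurable_itv.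
have mf k E : measurable_fun E (f k).
  by apply/measurable_EFinP; apply: measurable_funM.
have int_le : (\int[lebesgue_measure]_(x in I a b)
    (cst (boxvol (tl a) (tl b))%:E x) <=
    \int[lebesgue_measure]_(x in I a b) (\sum_(k <oo) f k x))%E.
  apply: ge0_le_integral => //; first exact: mI.
  - by move=> x _; rewrite /= lee_fin boxvol_ge0.
  - apply: (@ge0_emeasurable_sum _ _ _ _ f xpredT) => [k x _ _|k _].
      exact: f0.
    exact: mf.
  move=> x; rewrite /I/= in_itv/= => /andP[ax xb].
  pose D' k := D k && (x \in I (aa k) (bb k)).
  have := IHn (tl a) (tl b) (tl \o aa) (tl \o bb) D'.
  rewrite (_ : (fun n0 : nat => _) = (fun m => \sum_(0 <= k < m) f k x)%E).
    apply=> y yab.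
    pose z : 'rV[R]_n.+1 := \row_i oapp (fun j => y 0 j) x (unlift ord0 i).
    have [|k /= Dk zk] := cov z.
      move=> i; rewrite mxE; case: unliftP => [j ->|->] /=; last by rewrite ax.
      by have := yab j; rewrite !mxE.
    exists k => /=.
      apply/andP; split=> //; rewrite inE /I/= in_itv/=.
      by have := zk ord0; rewrite mxE unlift_none.
    move=> j; have := zk (lift ord0 j).
    by rewrite !mxE liftK.
  apply/funext => m; apply: eq_bigr => k _; congr EFin.
  by rewrite /v indicE /D' -mulnb natrM mulrAC.
rewrite boxvolS EFinM -lebesgue_measure_segment -integral_cst; last exact: mI.
apply: le_trans int_le _; rewrite integral_nneseries; [|exact: mI|by move=> k; exact: mf|by []].
apply: lee_nneseries => k _; first by move=> _; exact: integral_ge0.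
rewrite /f; under eq_integral do rewrite EFinM.
rewrite ge0_integralZl; first last.
- by rewrite lee_fin.
- by move=> x _; rewrite lee_fin.
- by apply/measurable_EFinP; apply: measurable_indic; exact: mI.
- exact: mI.
rewrite integral_indic//; [|exact: mI|exact: mI].
rewrite boxvolS mulrA -/(v k) [leRHS]EFinM; apply: lee_wpmul2l; first by rewrite lee_fin.
rewrite -lebesgue_measure_segment; apply: le_measure; rewrite ?inE.
- by apply: measurableI; exact: mI.
- exact: mI.
- exact: subIsetl.
Qed.

Lemma volume_box_ge (n : nat) (a b : 'rV[R]_n) :
  ((boxvol a b)%:E <= volume (box a b))%E.
Proof.
apply: le_ereal_inf_tmp => _ [aa [bb [cov ->]]].
have := @boxvol_le_cover n a b aa bb xpredT.
rewrite (_ : (fun m : nat => _) =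
  (fun m => \sum_(0 <= k < m) (boxvol (aa k) (bb k))%:E)%E).
  by apply => x /cov[k _ xk]; exists k.
by apply/funext => m; apply: eq_bigr => k _; rewrite mul1r.
Qed.

Lemma volume_box (n' : nat) (a b : 'rV[R]_n'.+1) :
  volume (box a b) = (boxvol a b)%:E.
Proof. by apply/eqP; rewrite eq_le volume_box_le volume_box_ge. Qed.

End BoxLower.

Section Inner.
Variables (R : realType) (n : nat).
Implicit Types u v x y : 'rV[R]_n.

Lemma innerC u x : inner u x = inner x u.
Proof. by apply: eq_bigr => i _; rewrite mulrC. Qed.

Lemma innerDr u x y : inner u (x + y) = inner u x + inner u y.
Proof. by rewrite -big_split; apply: eq_bigr => i _; rewrite !mxE mulrDr. Qed.

Lemma innerZr u c x : inner u (c *: x) = c * inner u x.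
Proof. by rewrite mulr_sumr; apply: eq_bigr => i _; rewrite !mxE mulrCA. Qed.

Lemma innerNr u x : inner u (- x) = - inner u x.
Proof. by rewrite -scaleN1r innerZr mulN1r. Qed.

Lemma innerBr u x y : inner u (x - y) = inner u x - inner u y.
Proof. by rewrite innerDr innerNr. Qed.

Lemma inner0r u : inner u 0 = 0.
Proof. by rewrite -(scale0r 0) innerZr mul0r. Qed.

Lemma inner_sumr (I : Type) (r : seq I) (P : pred I) (F : I -> 'rV[R]_n) u :
  inner u (\sum_(i <- r | P i) F i) = \sum_(i <- r | P i) inner u (F i).
Proof.
elim/big_rec2: _ => [|i x y _ <-]; first exact: inner0r.
by rewrite innerDr.
Qed.

Lemma innerZl c u x : inner (c *: u) x = c * inner u x.
Proof. by rewrite innerC innerZr innerC. Qed.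

Lemma innerBl u v x : inner (u - v) x = inner u x - inner v x.
Proof. by rewrite !(innerC _ x) innerBr. Qed.

Lemma inner0l x : inner 0 x = 0.
Proof. by rewrite innerC inner0r. Qed.

Lemma inner_delta u i : inner u (delta_mx 0 i) = u 0 i.
Proof.
rewrite /inner (bigD1 i)//= mxE !eqxx mulr1 big1 ?addr0// => j ji.
by rewrite mxE (negPf ji) andbF mulr0.
Qed.

Lemma inner_ge0 u : 0 <= inner u u.
Proof. by apply: sumr_ge0 => i _; rewrite -expr2 sqr_ge0. Qed.

Lemma inner_gt0 u : u != 0 -> 0 < inner u u.
Proof.
move=> u0; rewrite lt_def inner_ge0 andbT; apply: contra_neq u0 => uu0.
apply/rowP => i; apply/eqP; rewrite mxE -sqrf_eq0 expr2.
apply/eqP/(psumr_eq0P _ uu0) => // j _.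
by rewrite -expr2 sqr_ge0.
Qed.

End Inner.

(** * Measurable sets, null hyperplanes and additivity *)

Section Measurability.
Variables (R : realType) (n' : nat).
Local Notation n := n'.+1.
Local Notation vec := 'rV[R]_n.
Local Notation vol := (@volume R n).

(** Cutting every box of a cover at height [c] in direction [i] splits its volume exactly, so a
    cover of [X] splits into covers of its two parts. *)
Lemma measurable_coord_le (i : 'I_n) (c : R) :
  vol.-caratheodory [set x : vec | x 0 i <= c].
Proof.
apply: le_caratheodory_measurable => X.
apply: le_ereal_inf_tmp => _ [a [b [Xab ->]]].
pose b1 k : vec := \row_j (if j == i then Num.min (b k 0 j) c else b k 0 j).
pose a2 k : vec := \row_j (if j == i then Num.max (a k 0 j) c else a k 0 j).
have -> : (\sum_(k <oo) (boxvol (a k) (b k))%:E =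
    \sum_(k <oo) ((boxvol (a k) (b1 k))%:E + (boxvol (a2 k) (b k))%:E))%E.
  apply: eq_eseriesr => k _; rewrite -EFinD; congr EFin.
  have boxvolD1 (x y : vec) : boxvol x y = Num.max (y 0 i - x 0 i) 0 *
      \prod_(j | j != i) Num.max (y 0 j - x 0 j) 0 by rewrite /boxvol (bigD1 i).
  rewrite !boxvolD1 !mxE eqxx.
  set p := \prod_(_ < _ | _) _; set p1 := \prod_(_ < _ | _) _.
  set p2 := \prod_(_ < _ | _) _.
  have -> : p1 = p by apply: eq_bigr => j /negPf ji; rewrite !mxE ji.
  have -> : p2 = p by apply: eq_bigr => j /negPf ji; rewrite !mxE ji.
  rewrite -mulrDl; congr (_ * _).
  by rewrite /Num.min /Num.max; repeat case: ifPn; rewrite -?leNgt => *; lra.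
rewrite nneseriesD; [|by move=> *; rewrite lee_fin boxvol_ge0..].
apply: leeD; apply: volume_cover => x [/Xab [k _ xk] /= xc]; exists k => // j.
  rewrite !mxE; have /andP[-> xb] := xk j; case: eqP => // ji.
  by rewrite le_min xb ji xc.
rewrite !mxE; have /andP[ax ->] := xk j; case: eqP => [ji|_]; last by rewrite ax.
by rewrite ge_max ax ji andbT ltW// ltNge; apply/negP.
Qed.

Lemma measurable_half_open_box (a b : vec) :
  vol.-caratheodory [set x : vec | forall i, a 0 i < x 0 i <= b 0 i].
Proof.
rewrite [X in caratheodory_measurable _ X](_ : _ =
    ~` \bigcup_k ~` ([set x : vec | x 0 (inord k) <= b 0 (inord k)] `\`
                     [set x : vec | x 0 (inord k) <= a 0 (inord k)])); last first.
  rewrite setC_bigcup; apply/seteqP; split=> [x xab k _|x xab i].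
    by rewrite setCK; have /andP[axk xbk] := xab (inord k);
      split => //=; apply/negP; rewrite -ltNge.
  have := xab i Logic.I; rewrite setCK /= inord_val => -[xb xa].
  by rewrite xb andbT ltNge; apply/negP.
apply: caratheodory_measurable_setC; apply: caratheodory_measurable_bigcup => k.
apply: caratheodory_measurable_setC; apply: caratheodory_measurable_setD;
  exact: measurable_coord_le.
Qed.

(** An open set is the union of the half-open cells with rational corners that it contains, and
    these are countable. *)
Lemma measurable_open (A : set vec) :
  (forall x, A x -> exists2 r : R, 0 < r &
     forall y : vec, (forall i, `|y 0 i - x 0 i| <= r) -> A y) ->
  vol.-caratheodory A.
Proof.
move=> openA.
pose cell (q : 'rV[rat]_n * 'rV[rat]_n) : set vec :=
  [set x | forall i, ratr (q.1 0 i) < x 0 i <= ratr (q.2 0 i)].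
have mcell q : vol.-caratheodory (cell q).
  have := measurable_half_open_box (\row_i ratr (q.1 0 i)) (\row_i ratr (q.2 0 i)).
  by congr (_.-caratheodory _); apply/seteqP; split => x xq i; have := xq i;
    rewrite !mxE.
have -> : A = \bigcup_k (if @unpickle ('rV[rat]_n * 'rV[rat]_n)%type k is Some q
    then if `[< cell q `<=` A >] then cell q else set0 else set0).
  apply/seteqP; split=> [x Ax|x [k _]]; last first.
    by case: unpickle => // q; case: asboolP => // + xq; exact.
  have [r r0 xrA] := openA _ Ax.
  have lo i : exists q : rat, ratr q \in `]x 0 i - r, x 0 i[.
    by apply: rat_in_itvoo; rewrite ltrBlDr ltrDl.
  have hi i : exists q : rat, ratr q \in `]x 0 i, x 0 i + r[.
    by apply: rat_in_itvoo; rewrite ltrDl.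
  have [p pP] := choice lo; have [q qP] := choice hi.
  pose pq := (\row_i p i, \row_i q i); exists (pickle pq) => //.
  rewrite pickleK; case: asboolP => [_ i|[] y ypq].
    rewrite !mxE; have := pP i; have := qP i; rewrite !in_itv/=.
    by move=> /andP[/ltW -> _] /andP[_ ->].
  apply: xrA => i; have := ypq i; rewrite !mxE ler_distl.
  have := pP i; have := qP i; rewrite !in_itv/=.
  move=> /andP[_ qr] /andP[rp _] /andP[py yq].
  by rewrite (ltW (lt_trans rp py))/= (le_trans yq)// ltW.
apply: caratheodory_measurable_bigcup => k; case: unpickle => [q|]; last first.
  exact: caratheodory_measurable_set0.
by case: ifP => _ //; exact: caratheodory_measurable_set0.
Qed.

Lemma inner_open (u x : vec) (c : R) : c < inner u x ->
  exists2 r : R, 0 < r & forall y : vec, (forall i, `|y 0 i - x 0 i| <= r) -> c < inner u y.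
Proof.
move=> cux; pose s := \sum_i `|u 0 i|.
have s0 : 0 <= s by exact: sumr_ge0.
have s1 : 0 < s + 1 by rewrite ltr_wpDl.
exists ((inner u x - c) / (s + 1)) => [|y yx]; first by rewrite divr_gt0 ?subr_gt0.
have : `|inner u (y - x)| <= s * ((inner u x - c) / (s + 1)).
  rewrite mulr_suml; apply: le_trans (ler_norm_sum _ _ _) _.
  by apply: ler_sum => i _; rewrite normrM !mxE ler_wpM2l.
rewrite ler_norml => /andP[+ _]; rewrite innerBr => lo.
have : s * ((inner u x - c) / (s + 1)) < inner u x - c.
  rewrite mulrA ltr_pdivrMr// mulrC ltr_pM2l ?subr_gt0//.
  by rewrite ltrDl.
by lra.
Qed.

(** The dual form of being closed and convex. It is the form in which Farkas' lemma delivers it for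
    polytopes, and it makes the complement visibly open. *)
Definition separated (K : set vec) := forall x, ~ K x ->
  exists (u : vec) (c : R), c < inner u x /\ K `<=` [set y | inner u y <= c].

Lemma measurable_separated (K : set vec) :
  separated K -> vol.-caratheodory K.
Proof.
move=> sepK; rewrite -(setCK K); apply: caratheodory_measurable_setC.
apply: measurable_open => x /sepK[u [c [/inner_open[r r0 xr] Kuc]]].
by exists r => // y /xr cuy /Kuc /=; rewrite leNgt cuy.
Qed.

Lemma measurable_hyperplane (u : vec) (c : R) :
  vol.-caratheodory [set x | inner u x = c].
Proof.
apply: measurable_separated => x /= /eqP.
rewrite neq_lt => /orP[ux|ux]; [exists (-1 *: u), (- c)|exists u, c].
  by rewrite innerZl mulN1r ltrN2; split => // y /= <-; rewrite innerZl mulN1r.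
by split => // y /= <-.
Qed.

Lemma separated_box (a b : vec) : separated (box a b).
Proof.
move=> x /existsNP[i /negP]; rewrite negb_and -!ltNge.
case/orP => xi; [exists (-1 *: delta_mx 0 i), (- a 0 i)|exists (delta_mx 0 i), (b 0 i)].
  rewrite innerZl mulN1r innerC inner_delta ltrN2; split => // y /(_ i)/andP[ay _] /=.
  by rewrite innerZl mulN1r innerC inner_delta lerN2.
by rewrite innerC inner_delta; split => // y /(_ i)/andP[_] /=; rewrite innerC inner_delta.
Qed.

(** A bounded piece [H] of the hyperplane has [N + 1] disjoint translates, along a coordinate
    direction transversal to it, inside one box that does not depend on [N]. *)
Lemma volume_hyperplane (u : vec) (c : R) : u != 0 ->
  vol [set x | inner u x = c] = 0%E.
Proof.
move=> u0.
have [j uj] : exists j, u 0 j != 0.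
  apply/existsP; apply: contraNT u0; rewrite negb_exists => /forallP uN.
  by apply/eqP/rowP => j; rewrite mxE; have := uN j; rewrite negbK => /eqP.
apply/eqP; rewrite eq_le volume_ge0 andbT.
have sub : [set x | inner u x = c] `<=`
    \bigcup_k ([set x | inner u x = c] `&` box (const_mx (- k%:R)) (const_mx k%:R)).
  move=> x ux; pose k := (\max_(i < n) Num.truncn (`|x ord0 i|)%R)%N.
  exists k.+1 => //; split => // i; rewrite !mxE -ler_norml.
  apply: le_trans (ltW (truncnS_gt _)) _; rewrite ler_nat ltnS.
  exact: (leq_bigmax i).
apply: le_trans (le_volume sub) _; apply: le_trans (volume_sigma_subadditive _) _.
rewrite eseries0// => k _ _; apply/eqP; rewrite eq_le volume_ge0 andbT.
set H := _ `&` _; pose X : set vec := box (const_mx (- k.+1%:R)) (const_mx k.+1%:R).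
pose C := boxvol (const_mx (- k.+1%:R) : vec) (const_mx k.+1%:R).
have bound N : (N.+1%:R%:E * vol H <= C%:E)%E.
  pose A (m : nat) : set vec := [set x | inner u x = c + m%:R / N.+1%:R * u 0 j].
  have mA m : vol.-caratheodory (A m) by exact: measurable_hyperplane.
  have tA : trivIset setT A.
    apply/trivIsetP => p q _ _ pq; apply/seteqP; split => // x [].
    rewrite /A /= => -> /addrI/(mulIf uj)/mulIf.
    rewrite invr_eq0 pnatr_eq0 => /(_ isT)/eqP.
    by rewrite eqr_nat (negPf pq).
  apply: le_trans (volume_box_le _ _); rewrite -/X.
  apply: (@le_trans _ _ (vol (X `&` \big[setU/set0]_(i < N.+1) A i))); last first.
    by apply: le_volume; exact: subIsetl.
  rewrite (caratheodory_additive mA tA).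
  apply: (@le_trans _ _ (\sum_(i < N.+1) vol H)%E).
    by rewrite sumr_const card_ord mule_natl.
  apply: lee_sum => i _.
  rewrite -(volume_translate (i%:R / N.+1%:R *: delta_mx 0 j)).
  apply: le_volume => _ [x [ux xk] <-]; split=> [l|]; last first.
    by rewrite /A/= innerDr innerZr inner_delta ux addrC.
  have t01 : 0 <= (i%:R / N.+1%:R : R) <= 1.
    apply/andP; split; first by rewrite divr_ge0.
    by rewrite ler_pdivrMr ?ltr0n// mul1r ler_nat ltnW.
  have := xk l; rewrite !mxE -[k.+1%:R]natr1; move: (_ / _) t01 => t t01.
  by case: (l == j) => /=; rewrite ?mulr1 ?mulr0; move: t01; lra.
have volHfin : vol H \is a fin_num.
  rewrite ge0_fin_numE ?volume_ge0//; have := bound 0%N; rewrite mul1e => /le_lt_trans.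
  by apply; rewrite ltry.
move: bound; rewrite -(fineK volHfin) => bound; rewrite lee_fin leNgt; apply/negP => h0.
have := bound (Num.truncn (C / fine (vol H))); rewrite -EFinM lee_fin leNgt.
by rewrite -ltr_pdivrMr// truncnS_gt.
Qed.

Lemma volume_null_sub (A B : set vec) : A `<=` B -> vol B = 0%E -> vol A = 0%E.
Proof.
by move=> /le_volume AB B0; apply/eqP; rewrite eq_le volume_ge0 -B0 AB.
Qed.

Lemma volumeU (A B : set vec) : vol.-caratheodory A -> vol (B `&` A) = 0%E ->
  vol (A `|` B) = (vol A + vol B)%E.
Proof.
move=> mA BA0; rewrite (mA (A `|` B)) (mA B) BA0 add0e; congr (vol _ + vol _)%E.
  by rewrite setUK.
by rewrite setIUl setICr set0U.
Qed.

Lemma volume_null_overlap (I : choiceType) (s : seq I) (K : I -> set vec) : uniq s ->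
  (forall i, i \in s -> vol.-caratheodory (K i)) ->
  (forall i j, i \in s -> j \in s -> i != j -> vol (K i `&` K j) = 0%E) ->
  vol [set x | exists2 i, i \in s & K i x] = (\sum_(i <- s) vol (K i))%E.
Proof.
elim: s => [_ _ _|i s IHs /= /andP[isN us] mK K0].
  rewrite big_nil (_ : [set x | _] = set0) ?volume_set0//.
  by apply/seteqP; split => x // -[].
rewrite big_cons -IHs//; last 2 first.
- by move=> j js; apply: mK; rewrite inE js orbT.
- by move=> j k js ks; apply: K0; rewrite inE ?js ?ks orbT.
set B := [set x | exists2 j, j \in s & K j x].
have -> : [set x | exists2 j, j \in i :: s & K j x] = K i `|` B.
  apply/seteqP; split=> [x [j]|x [Kix|[j js Kjx]]].
  - by rewrite inE => /orP[/eqP->|js Kjx]; [left|right; exists j].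
  - by exists i => //; rewrite inE eqxx.
  - by exists j => //; rewrite inE js orbT.
have mKi : vol.-caratheodory (K i) by apply: mK; rewrite inE eqxx.
apply: volumeU => //.
apply: (@volume_null_sub _ (\big[setU/set0]_(j <- s) (K j `&` K i))).
    by move=> x [[j js Kjx] Kix]; rewrite -bigcup_seq; exists j.
  rewrite big_seq; elim/big_ind: _ => [|P Q P0 Q0|j js].
  - exact: volume_set0.
  - apply/eqP; rewrite eq_le volume_ge0 andbT.
    by apply: le_trans (outer_measureU2 _ _ _) _; rewrite /= P0 Q0 adde0.
  - apply: K0; rewrite ?inE ?js ?eqxx ?orbT//.
    by apply: contraNneq isN => <-.
Qed.

End Measurability.

(** * Volumes under invertible linear maps *)

Section LinearImage.
Variable R : realType.

(** Cauchy's functional equation. Nonnegativity makes [f] monotone, and comparing [N x] with its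
    integer part bounds [N |f x - x f 1|] by [f 1] for every [N]. *)
Lemma additive_ge0_linear (f : R -> R) :
  (forall x, 0 <= x -> 0 <= f x) ->
  (forall x y, 0 <= x -> 0 <= y -> f (x + y) = f x + f y) ->
  forall x, 0 <= x -> f x = x * f 1.
Proof.
move=> f0 fD x x0.
have fk k y : 0 <= y -> f (k%:R * y) = k%:R * f y.
  move=> y0; elim: k => [|k IHk].
    by rewrite !mul0r; have := fD 0 0; rewrite addr0 lexx => /(_ isT isT); lra.
  by rewrite -!natr1 !mulrDl !mul1r fD ?mulr_ge0// IHk.
have fle y z : 0 <= y -> y <= z -> f y <= f z.
  by move=> y0 yz; rewrite -(subrK y z) addrC fD ?subr_ge0// lerDl f0 ?subr_ge0.
have f10 : 0 <= f 1 by exact: f0.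
have close N : N%:R * `|f x - x * f 1| <= f 1.
  have Nx0 : 0 <= N%:R * x by rewrite mulr_ge0.
  have /andP[] := truncn_itv Nx0; set m := Num.truncn _ => mN Nm.
  have lo : m%:R * f 1 <= N%:R * f x by rewrite -!fk ?mulr1// fle.
  have hi : N%:R * f x <= m.+1%:R * f 1 by rewrite -!fk ?mulr1// fle// ltW.
  rewrite -[N%:R]normr_nat -normrM ler_norml; apply/andP; split.
    by move: Nm hi => /ltW/(ler_wpM2r f10); rewrite -natr1; lra.
  by move: mN lo => /(ler_wpM2r f10); move: Nm hi; rewrite -natr1; nra.
apply/eqP; rewrite -subr_eq0 -normr_le0 leNgt; apply/negP => d0.
have := close (Num.truncn (f 1 / `|f x - x * f 1|)).+1.
by rewrite leNgt -ltr_pdivrMr// truncnS_gt.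
Qed.

Lemma inner_mulmx (n : nat) (u y : 'rV[R]_n) (A : 'M[R]_n) :
  inner u (y *m A) = inner (u *m A^T) y.
Proof.
have innerE (v x : 'rV[R]_n) : inner v x = (v *m x^T) 0 0.
  by rewrite mxE; apply: eq_bigr => i _; rewrite mxE.
by rewrite !innerE trmx_mul mulmxA.
Qed.

Variable n' : nat.
Local Notation n := n'.+1.
Local Notation vec := 'rV[R]_n.
Local Notation vol := (@volume R n).

Lemma volume_box_lt_oo (a b : vec) (A : set vec) : A `<=` box a b -> (vol A < +oo)%E.
Proof.
by move=> /le_volume/le_lt_trans; apply; rewrite volume_box ltry.
Qed.

Lemma separated_mulmx (M : 'M[R]_n) (K : set vec) : M \in unitmx -> separated K ->
  separated [set x *m M | x in K].
Proof.
move=> uM sepK y NKy.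
have [|u [c [cu Ku]]] := sepK (y *m invmx M).
  by move=> Ky; apply: NKy; exists (y *m invmx M) => //; rewrite mulmxKV.
exists (u *m (invmx M)^T), c; rewrite -inner_mulmx; split => // _ [x Kx <-] /=.
by rewrite -inner_mulmx mulmxK//; exact: Ku.
Qed.

Lemma mulmx_box_bounded (M : 'M[R]_n) (a b : vec) :
  exists c d : vec, [set x *m M | x in box a b] `<=` box c d.
Proof.
pose r i := `|a 0 i| + `|b 0 i|; pose d : vec := \row_j \sum_i r i * `|M i j|.
exists (- d), d => _ [x xab <-] j; rewrite !mxE -ler_norml.
apply: le_trans (ler_norm_sum _ _ _) _; apply: ler_sum => i _.
rewrite normrM ler_wpM2r// /r ler_norml; have /andP[ax xb] := xab i.
have := ler_norm (- a 0 i); have := ler_norm (b 0 i); rewrite normrN.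
by have := normr_ge0 (a 0 i); have := normr_ge0 (b 0 i); lra.
Qed.

Section Image.
Variable M : 'M[R]_n.
Hypothesis uM : M \in unitmx.

Let im (A : set vec) : set vec := [set x *m M | x in A].

Let im_inj (x y : vec) : x *m M = y *m M -> x = y.
Proof. by move=> /(congr1 (mulmx^~ (invmx M))); rewrite !mulmxK. Qed.

Let imI (A B : set vec) : im A `&` im B `<=` im (A `&` B).
Proof. by move=> _ [[x Ax <-] [y By /im_inj yx]]; exists x => //; rewrite -yx in Ax *. Qed.

Let im_translate (v : vec) (A : set vec) : vol (im [set v + x | x in A]) = vol (im A).
Proof.
rewrite -[RHS](volume_translate (v *m M)); congr (vol _).
apply/seteqP; split=> [_ [_ [x Ax <-] <-]|_ [_ [x Ax <-] <-]].
  by exists (x *m M); [exists x|rewrite mulmxDl].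
by exists (v + x); [exists x|rewrite mulmxDl].
Qed.

Let mim (a b : vec) : vol.-caratheodory (im (box a b)).
Proof. exact/measurable_separated/separated_mulmx/separated_box. Qed.

Let im_fin (a b : vec) (A : set vec) : A `<=` box a b -> vol (im A) \is a fin_num.
Proof.
move=> Aab; rewrite ge0_fin_numE ?volume_ge0//.
have [c [d abcd]] := mulmx_box_bounded M a b.
by apply: (@volume_box_lt_oo c d); apply: subset_trans abcd; exact: image_subset.
Qed.

(** The volume of the image parallelepiped as a function of the side lengths. Cutting along a null
    hyperplane makes it additive in each side, hence multilinear, so its value at the unit cube is
    the scaling factor. *)
Let g (s : 'I_n -> R) : R := fine (vol (im (box 0 (\row_i s i)))).

Let upd (s : 'I_n -> R) i p j := if j == i then p else s j.

Let g_add (s : 'I_n -> R) (i : 'I_n) (p q : R) : 0 <= p -> 0 <= q ->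
  g (upd s i (p + q)) = g (upd s i p) + g (upd s i q).
Proof.
move=> p0 q0; rewrite /g -fineD; [|exact: im_fin (@subset_refl _ _)..]; congr fine.
rewrite -(im_translate (p *: delta_mx 0 i) (box _ (\row_j upd s i q j))).
have updE t j : (\row_j upd s i t j) 0 j = if j == i then t else s j by rewrite mxE.
rewrite -volumeU//; last first.
  apply: (@volume_null_sub _ _ _ [set y | inner (delta_mx 0 i *m (invmx M)^T) y = p]).
    move=> y /imI[x [[z zq <-]] + <-] /=.
    rewrite -inner_mulmx mulmxK// innerC inner_delta => /(_ i).
    have := zq i; rewrite !updE !mxE !eqxx mulr1; lra.
  apply: volume_hyperplane; apply/eqP => /(congr1 (mulmx^~ M^T)).
  rewrite /= trmx_inv mulmxKV ?unitmx_tr// mul0mx => /matrixP/(_ 0 i)/eqP.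
  by rewrite !mxE !eqxx oner_eq0.
congr (vol _); rewrite /im -image_setU; congr (_ @` _).
apply/seteqP; split=> [x xpq|x [xp|[y yq <-]]] //.
- have [xp|px] := leP (x 0 i) p; [left|right; exists (x - p *: delta_mx 0 i)].
  + by move=> j; have := xpq j; rewrite !updE mxE; case: eqP => // ->; rewrite xp andbT => /andP[].
  + move=> j; have := xpq j; rewrite !updE !mxE eqxx /=; case: eqP => [->|_] /=.
      by rewrite mulr1; move: px; lra.
    by rewrite mulr0 subr0.
  + by rewrite addrC subrK.
- by move=> j; have := xp j; rewrite !updE mxE; case: eqP => // _; move: q0; lra.
- move=> j; have := yq j; rewrite !updE !mxE eqxx /=; case: eqP => [->|_] /=.
    by rewrite mulr1; move: p0; lra.
  by rewrite mulr0 add0r.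
Qed.

Let g_prod (s : 'I_n -> R) : (forall i, 0 <= s i) -> g s = g (fun=> 1) * \prod_i s i.
Proof.
move=> s0.
have step (r : seq 'I_n) : uniq r -> g s =
    (\prod_(i <- r) s i) * g (fun j => if j \in r then 1 else s j).
  elim: r => [|i r IHr] /=; first by rewrite big_nil mul1r.
  move=> /andP[ir /IHr ->]; rewrite big_cons [s i * _]mulrC -mulrA; congr (_ * _).
  pose t j := if j \in r then 1 else s j.
  have := @additive_ge0_linear (fun p => g (upd t i p)).
  move=> /(_ _ _ (s i)); rewrite (_ : upd t i (s i) = t); last first.
    by apply/funext => j; rewrite /upd /t; case: eqP => [->|//]; rewrite (negPf ir).
  rewrite (_ : upd t i 1 = fun j => if j \in i :: r then 1 else s j); last first.
    by apply/funext => j; rewrite /upd /t inE; case: eqP.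
  apply => //; first by move=> x _; rewrite /g fine_ge0// volume_ge0.
  by move=> x y x0 y0; exact: g_add.
rewrite (step (enum 'I_n)) ?enum_uniq// big_enum mulrC; congr (g _ * _).
by apply/funext => j; rewrite mem_enum.
Qed.

Lemma volume_mulmx_box (a b : vec) :
  vol [set x *m M | x in box a b] = (g (fun=> 1) * boxvol a b)%:E.
Proof.
have [ab|/existsNP[i /negP]] := pselect (forall i, a 0 i <= b 0 i); last first.
  rewrite -ltNge => ba; rewrite (_ : box a b = set0); last first.
    by apply/seteqP; split => // x /(_ i); move: ba; lra.
  rewrite image_set0 volume_set0 /boxvol (bigD1 i)//= max_r ?mul0r ?mulr0//.
  by rewrite subr_le0 ltW.
have -> : box a b = [set a + x | x in box 0 (\row_i (b 0 i - a 0 i))].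
  apply/seteqP; split=> [x xab|_ [x xab <-]].
    exists (x - a); last by rewrite addrC subrK.
    by move=> i; have := xab i; rewrite !mxE; lra.
  by move=> i; have := xab i; rewrite !mxE; lra.
rewrite -[LHS]/(vol (im _)) im_translate -(fineK (im_fin (@subset_refl _ _))).
congr EFin; rewrite -/(g _) g_prod; last by move=> i; rewrite subr_ge0.
by congr (_ * _); apply: eq_bigr => i _; rewrite max_l// subr_ge0.
Qed.

Lemma volume_mulmx_le (c : R) (A : set vec) : 0 < c -> g (fun=> 1) <= c ->
  (vol [set x *m M | x in A] <= c%:E * vol A)%E.
Proof.
move=> c0 gc; apply: volume_image_le => // a b.
by rewrite volume_mulmx_box lee_fin ler_wpM2r ?boxvol_ge0.
Qed.

End Image.

(** The factor is exact on boxes and an upper bound on all sets; the bound for the complement of [Y]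
    in a box yields the lower bound for [Y]. The factor is positive because the inverse map carries
    the image of the unit cube back to the cube, of volume 1. *)
Lemma volume_mulmx (M : 'M[R]_n) : M \in unitmx ->
  exists2 c : R, 0 < c & forall (Y : set vec) (a b : vec),
    separated Y -> Y `<=` box a b -> vol [set x *m M | x in Y] = (c%:E * vol Y)%E.
Proof.
move=> uM.
have [c cbox cle] : exists2 c, (forall a b : vec,
    vol [set x *m M | x in box a b] = (c * boxvol a b)%:E) &
    forall c' A, 0 < c' -> c <= c' -> (vol [set x *m M | x in A] <= c'%:E * vol A)%E.
  by eexists; [exact: volume_mulmx_box|move=> c' A; exact: volume_mulmx_le].
have [d dle] : exists d : R, forall c' A, 0 < c' -> d <= c' ->
    (vol [set x *m invmx M | x in A] <= c'%:E * vol A)%E.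
  by eexists => c' A; apply: volume_mulmx_le; rewrite unitmx_inv.
pose o : vec := const_mx 1.
have o1 : boxvol 0 o = 1.
  by rewrite /boxvol big1// => i _; rewrite !mxE subr0 max_l.
have c0 : 0 < c.
  have := dle (Num.max d 1) [set x *m M | x in box 0 o].
  rewrite lt_max ltr01 orbT le_max lexx => /(_ isT isT).
  rewrite cbox o1 mulr1 image_comp (_ : _ @` _ = box 0 o); last first.
    apply/seteqP; split=> [_ [x xo <-]|x xo]; rewrite /= ?mulmxK//.
    by exists x; rewrite //= mulmxK.
  rewrite volume_box o1 -EFinM lee_fin => h.
  have : 0 < Num.max d 1 * c by apply: lt_le_trans h.
  by rewrite pmulr_rgt0// lt_max ltr01 orbT.
exists c => // Y a b sepY Yab; apply/eqP; rewrite eq_le cle//=.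
have mY := measurable_separated sepY.
have mMY := measurable_separated (separated_mulmx uM sepY).
have YD : vol (box a b) = (vol Y + vol (box a b `\` Y))%E.
  by rewrite (mY (box a b)) setIidr.
have Yfin : vol Y \is a fin_num.
  by rewrite ge0_fin_numE ?volume_ge0// (volume_box_lt_oo Yab).
have Dfin : vol (box a b `\` Y) \is a fin_num.
  by rewrite ge0_fin_numE ?volume_ge0// (@volume_box_lt_oo a b)//; exact: subDsetl.
have [x [y xy]] := mulmx_box_bounded M a b.
have MYfin : vol [set x *m M | x in Y] \is a fin_num.
  rewrite ge0_fin_numE ?volume_ge0// (@volume_box_lt_oo x y)//.
  by apply: subset_trans xy; exact: image_subset.
have := mMY [set x *m M | x in box a b]; rewrite setIidr; last exact: image_subset.
rewrite -setDE (_ : _ `\` _ = [set x *m M | x in box a b `\` Y]); last first.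
  apply/seteqP; split=> [_ [[z zab <-] NY]|_ [z [zab Yz] <-]].
    by exists z => //; split => // Yz; apply: NY; exists z.
  split; first by exists z.
  by move=> [t Yt /(congr1 (mulmx^~ (invmx M)))]; rewrite !mulmxK// => tz; apply: Yz; rewrite -tz.
have := cle c (box a b `\` Y) c0 (lexx c).
rewrite cbox EFinM -volume_box YD.
have MDfin : vol [set x *m M | x in box a b `\` Y] \is a fin_num.
  rewrite ge0_fin_numE ?volume_ge0// (@volume_box_lt_oo x y)//.
  by apply: subset_trans xy; apply: image_subset; exact: subDsetl.
rewrite -(fineK Yfin) -(fineK Dfin) -(fineK MYfin) -(fineK MDfin).
rewrite -EFinD -!EFinM -EFinD => + [] => + h.
by rewrite !lee_fin; move: h; lra.
Qed.

End LinearImage.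

(** * Subdivisions of Minkowski sums *)

Section Farkas.
Variable R : realType.

(* Bartl's induction: a point violating the conclusion for the tail of the
   family must violate the head inequality, and projecting along it reduces to
   the tail. *)
Lemma farkas_seq (m : nat) (I : eqType) (r : seq I) (v : I -> 'rV[R]_m) (b : 'rV[R]_m) :
  uniq r ->
  (forall y, (forall i, i \in r -> inner (v i) y <= 0) -> inner b y <= 0) ->
  exists2 c : I -> R, (forall i, 0 <= c i) & b = \sum_(i <- r) c i *: v i.
Proof.
elim: r v b => [|i0 r IHr] v b /=.
  move=> _ /(_ b) bb; exists (fun=> 0) => //; rewrite big_nil.
  apply/eqP; apply: contraTT isT => /inner_gt0; rewrite ltNge => /negP[].
  exact: bb.
move=> /andP[i0r ur] imp.
have ext (c : I -> R) a : 0 <= a -> (forall i, 0 <= c i) ->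
    b - a *: v i0 = \sum_(i <- r) c i *: v i ->
    exists2 c : I -> R, (forall i, 0 <= c i) & b = \sum_(i <- i0 :: r) c i *: v i.
  move=> a0 c0 bE; exists (fun i => if i == i0 then a else c i).
    by move=> i; case: eqP.
  rewrite big_cons eqxx -[LHS](subrK (a *: v i0)) addrC bE; congr (_ + _).
  rewrite !big_seq; apply: eq_bigr => i ir; case: eqP => // ii0.
  by rewrite -ii0 ir in i0r.
have [imp'|/existsNP[x /not_implyP[xr /negP]]] := pselect (forall y,
    (forall i, i \in r -> inner (v i) y <= 0) -> inner b y <= 0).
  have [c c0 bE] := IHr v b ur imp'.
  by apply: (ext c 0) => //; rewrite scale0r subr0.
rewrite -ltNge => bx.
have v0x : 0 < inner (v i0) x.
  rewrite ltNge; apply: contraL bx => v0x; rewrite -leNgt; apply: imp => i.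
  by rewrite inE => /orP[/eqP->//|]; exact: xr.
pose t := (inner (v i0) x)^-1; have t0 : 0 < t by rewrite invr_gt0.
have tE : t * inner (v i0) x = 1 by rewrite mulVf// gt_eqF.
have [c c0 bE] : exists2 c : I -> R, (forall i, 0 <= c i) &
    b - (t * inner b x) *: v i0 =
      \sum_(i <- r) c i *: (v i - (t * inner (v i) x) *: v i0).
  apply: IHr => // y yr.
  have key u : inner (u - (t * inner u x) *: v i0) y =
      inner u (y - (t * inner (v i0) y) *: x).
    by rewrite innerBl innerBr innerZl innerZr; ring.
  rewrite key; apply: imp => i; rewrite inE => /orP[/eqP->|/yr]; last by rewrite key.
  by rewrite innerBr innerZr mulrAC tE mul1r subrr.
apply: (ext c (t * inner b x - \sum_(i <- r) c i * (t * inner (v i) x))) => //.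
  rewrite subr_ge0; apply: le_trans (_ : 0 <= _); last by rewrite mulr_ge0 ?ltW.
  rewrite big_seq; apply: sumr_le0 => i ir.
  by rewrite mulr_ge0_le0// pmulr_rle0// xr.
rewrite scalerBl opprB addrA addrAC bE scaler_suml -big_split /=.
by apply: eq_bigr => i _; rewrite scalerBr scalerA subrK.
Qed.

Lemma farkas (m : nat) (I : finType) (P : pred I) (v : I -> 'rV[R]_m) (b : 'rV[R]_m) :
  (exists c : I -> R, [/\ forall i, 0 <= c i, forall i, ~~ P i -> c i = 0 &
     b = \sum_i c i *: v i]) \/
  (exists2 y, (forall i, P i -> inner (v i) y <= 0) & 0 < inner b y).
Proof.
have [imp|/existsNP[y /not_implyP[yP /negP]]] := pselect (forall y,
    (forall i, P i -> inner (v i) y <= 0) -> inner b y <= 0); last first.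
  by rewrite -ltNge; right; exists y.
left; have [||c c0 bE] := @farkas_seq m I (enum P) v b.
- exact: enum_uniq.
- by move=> y yP; apply: imp => i Pi; apply: yP; rewrite mem_enum.
exists (fun i => if P i then c i else 0); split => [i|i /negPf->//|].
  by case: ifP.
rewrite bE big_enum/= big_mkcond; apply: eq_bigr => i _.
by rewrite unfold_in; case: ifP => //; rewrite scale0r.
Qed.

(** Packs a point, its colour vector and its height, so that one application of Farkas' lemma treats
    all constraints. A certificate then splits into a normal [w], one level per colour [z], and a
    height coefficient [s]. *)
Definition row3 (n : nat) (a b : 'rV[R]_n) (c : R) : 'rV[R]_(n + n + 1) :=
  row_mx (row_mx a b) (const_mx c).

Lemma inner_row3 (n : nat) (a b a' b' : 'rV[R]_n) (c c' : R) :
  inner (row3 a b c) (row3 a' b' c') = inner a a' + inner b b' + c * c'.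
Proof.
rewrite /inner !big_split_ord/= big_ord1 /row3 !row_mxEr !mxE.
congr (_ + _ + _); apply: eq_bigr => i _.
  by rewrite !row_mxEl.
by rewrite !row_mxEl !row_mxEr.
Qed.

Lemma row3E (n : nat) (y : 'rV[R]_(n + n + 1)) :
  exists a b c, y = row3 a b c.
Proof.
exists (lsubmx (lsubmx y)), (rsubmx (lsubmx y)), (rsubmx y 0 0).
rewrite /row3 hsubmxK -[LHS]hsubmxK; congr row_mx.
by apply/matrixP => i j; rewrite !ord1 [RHS]mxE.
Qed.

Lemma row3_inj (n : nat) (a b a' b' : 'rV[R]_n) (c c' : R) :
  row3 a b c = row3 a' b' c' -> [/\ a = a', b = b' & c = c'].
Proof.
move=> /eq_row_mx[/eq_row_mx[-> ->] /matrixP/(_ 0 0)].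
by rewrite !mxE.
Qed.

Lemma row3_sum (n : nat) (I : finType) (k : I -> R) (a b : I -> 'rV[R]_n) (c : I -> R) :
  \sum_i k i *: row3 (a i) (b i) (c i) =
    row3 (\sum_i k i *: a i) (\sum_i k i *: b i) (\sum_i k i * c i).
Proof.
have row_mx_sum n1 n2 (A : I -> 'rV[R]_n1) (B : I -> 'rV[R]_n2) :
    \sum_i k i *: row_mx (A i) (B i) = row_mx (\sum_i k i *: A i) (\sum_i k i *: B i).
  elim/big_rec3: _ => [|i z y x _ ->]; first by rewrite row_mx0.
  by rewrite scale_row_mx add_row_mx.
rewrite !row_mx_sum; congr row_mx; apply/rowP => j.
by rewrite summxE mxE; apply: eq_bigr => i _; rewrite !mxE.
Qed.

End Farkas.

(** * Weighted sums of a coloured configuration and their cells *)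

Section Configuration.
Variables (R : realType) (n' : nat) (E : finType).
Local Notation n := n'.+1.
Local Notation vec := 'rV[R]_n.
Local Notation vol := (@volume R n).
Variables (g : E -> 'I_n) (p : E -> vec).
Implicit Types (S T : {set E}) (l : 'I_n -> R) (c : E -> R) (w x : vec) (om : E -> R).

(* The points [p e] with [e \in S] and [g e = i] span the i-th polytope, and
   [cayley_sum S l] is the Minkowski sum of these polytopes weighted by [l]. *)
Record coef S l x c : Prop := Coef {
  coef_ge0 : forall e, 0 <= c e;
  coef_supp : forall e, e \notin S -> c e = 0;
  coef_color : forall i, \sum_(e | g e == i) c e = l i;
  coef_point : x = \sum_e c e *: p e }.

Definition cayley_sum S l : set vec := [set x | exists c, coef S l x c].

Definition full S := forall i, exists2 e, e \in S & g e = i.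

Lemma coef_sub S T l x c : S \subset T -> coef S l x c -> coef T l x c.
Proof.
move=> /fintype.subsetP ST [c0 cS cl cx]; split => // e eT; apply: cS.
by apply: contra eT; exact: ST.
Qed.

Lemma cayley_sum_sub S T l : S \subset T -> cayley_sum S l `<=` cayley_sum T l.
Proof. by move=> ST x [c xc]; exists c; exact: coef_sub xc. Qed.

Lemma color_sum c (z : 'I_n -> R) l : (forall i, \sum_(e | g e == i) c e = l i) ->
  \sum_e c e * z (g e) = \sum_i l i * z i.
Proof.
move=> cl; rewrite (partition_big g xpredT)//=; apply: eq_bigr => i _.
by rewrite -cl mulr_suml; apply: eq_bigr => e /eqP->.
Qed.

Lemma color_delta_sum c (l : 'I_n -> R) :
  (\sum_e c e *: (delta_mx 0 (g e) : vec) = \row_i l i) <->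
  (forall i, \sum_(e | g e == i) c e = l i).
Proof.
have sE i : (\sum_e c e *: (delta_mx 0 (g e) : vec)) 0 i = \sum_(e | g e == i) c e.
  rewrite summxE [RHS]big_mkcond/=; apply: eq_bigr => e _.
  by rewrite !mxE eqxx/= eq_sym; case: eqP; rewrite ?mulr1 ?mulr0.
split=> [cl i|cl]; first by rewrite -sE cl mxE.
by apply/rowP => i; rewrite sE cl mxE.
Qed.

Lemma coef_inner S l x c w : coef S l x c -> inner w x = \sum_e c e * inner w (p e).
Proof. by case=> _ _ _ ->; rewrite inner_sumr; apply: eq_bigr => e _; rewrite innerZr. Qed.

Lemma coef_le S l x c (a b : E -> R) : coef S l x c ->
  (forall e, e \in S -> a e <= b e) -> \sum_e c e * a e <= \sum_e c e * b e.
Proof.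
case=> c0 cS _ _ ab; apply: ler_sum => e _.
have [eS|/cS->] := boolP (e \in S); last by rewrite !mul0r.
by rewrite ler_wpM2l// ab.
Qed.

(** Membership is solvability of a linear system in nonnegative unknowns. In a certificate of
    unsolvability, [w] separates and the colour levels [z], weighted by [l], give the threshold. *)
Lemma separated_cayley_sum S l : separated (cayley_sum S l).
Proof.
move=> x NKx.
have [[c [c0 cS]]|[y yS]] := farkas (mem S)
    (fun e => row3 (p e) (delta_mx 0 (g e)) 0) (row3 x (\row_i l i) 0).
  rewrite row3_sum => /row3_inj[xE /esym/color_delta_sum cl _].
  by case: NKx; exists c.
have [w [z [s yE]]] := row3E y; rewrite {}yE in yS *.
rewrite inner_row3 mul0r addr0 => xw.
exists w, (- \sum_i l i * z 0 i); rewrite -subr_gt0 opprK; split.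
  move: xw; rewrite innerC; congr (_ < _ + _).
  by apply: eq_bigr => i _; rewrite mxE.
move=> x' [c xc] /=; rewrite (coef_inner _ xc) -(color_sum _ (coef_color xc)).
rewrite -sumrN; under [leRHS]eq_bigr do rewrite -mulrN.
apply: coef_le xc _ => e eS; have := yS e eS.
by rewrite inner_row3 mul0r addr0 innerC [X in _ + X]innerC inner_delta; lra.
Qed.

Lemma cayley_sum_bounded S l : exists a b : vec, cayley_sum S l `<=` box a b.
Proof.
pose d : vec := \row_j \sum_e l (g e) * `|p e 0 j|.
exists (- d), d => _ [c [c0 cS cl ->]] j; rewrite !mxE -ler_norml summxE.
apply: le_trans (ler_norm_sum _ _ _) _; apply: ler_sum => e _.
rewrite mxE normrM ler_wpM2r// ger0_norm// -cl (bigD1 e)//= lerDl.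
exact: sumr_ge0.
Qed.

Lemma volume_cayley_sum_fin S l : vol (cayley_sum S l) \is a fin_num.
Proof.
have [a [b Kab]] := cayley_sum_bounded S l.
by rewrite ge0_fin_numE ?volume_ge0// (volume_box_lt_oo Kab).
Qed.

Definition lifted om w e := inner w (p e) + om e.

(* The face of the lifted configuration with outer normal [(w, 1)]. *)
Definition tight S om w : {set E} := [set e in S |
  [forall e' in S, (g e' == g e) ==> (lifted om w e' <= lifted om w e)]].

Lemma tight_sub S om w : tight S om w \subset S.
Proof. by apply/fintype.subsetP => e; rewrite inE => /andP[]. Qed.

Lemma tight_max S om w : full S -> exists z : 'I_n -> R,
  (forall e, e \in S -> lifted om w e <= z (g e)) /\
  (forall e, (e \in tight S om w) = (e \in S) && (lifted om w e == z (g e))).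
Proof.
move=> fS.
have max i : exists e, [/\ e \in S, g e = i &
    forall e', e' \in S -> g e' = i -> lifted om w e' <= lifted om w e].
  have [e0 e0S ge0] := fS i; pose P := [pred e | (e \in S) && (g e == i)].
  have Pe0 : P e0 by rewrite /= e0S ge0 eqxx.
  case: (Order.TotalTheory.arg_maxP (lifted om w) Pe0) => e /= /andP[eS /eqP ge] emax.
  by exists e; split => // e' e'S ge'; apply: emax; rewrite /= e'S ge' eqxx.
have [m mP] := choice max.
exists (lifted om w \o m); split=> [e eS|e]; first by have [_ _] := mP (g e); apply.
rewrite inE; have [eS/=|//] := boolP (e \in S).
have [meS gme mmax] := mP (g e); apply/forallP/eqP => [eP|eE e'].
  apply/eqP; rewrite eq_le mmax//=.
  by have := eP (m (g e)); rewrite meS gme eqxx.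
by apply/implyP => e'S; apply/implyP => /eqP ge'; rewrite eE mmax.
Qed.

Lemma tight_full S om w : full S -> full (tight S om w).
Proof.
move=> fS i; have [e0 e0S ge0] := fS i.
pose P := [pred e | (e \in S) && (g e == i)].
have Pe0 : P e0 by rewrite /= e0S ge0 eqxx.
case: (Order.TotalTheory.arg_maxP (lifted om w) Pe0) => e /= /andP[eS /eqP ge] emax.
exists e => //; rewrite inE eS; apply/forallP => e'; apply/implyP => e'S.
by apply/implyP => /eqP ge'; apply: emax; rewrite /= e'S ge' ge eqxx.
Qed.

(** [r] is the value of the support function of the lifted sum at [(w, 1)]; representations by
    points of the cell are those where every summand is maximal. *)
Lemma tight_value S om w l : full S -> exists r : R,
  (forall x c, coef S l x c -> inner w x + \sum_e c e * om e <= r) /\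
  (forall x c, coef (tight S om w) l x c -> inner w x + \sum_e c e * om e = r).
Proof.
move=> /(tight_max om w)[z [zS zT]]; exists (\sum_i l i * z i).
have E1 T x c : coef T l x c ->
    inner w x + \sum_e c e * om e = \sum_e c e * lifted om w e.
  move=> xc; rewrite (coef_inner _ xc) -big_split; apply: eq_bigr => e _.
  by rewrite /= -mulrDr.
split=> x c xc; rewrite (E1 _ _ _ xc) -(color_sum _ (coef_color xc)).
  exact: coef_le xc _.
apply: eq_bigr => e _; have [|eT] := boolP (e \in tight S om w).
  by rewrite zT => /andP[_ /eqP->].
by rewrite (coef_supp xc eT) !mul0r.
Qed.

(** Farkas' lemma shows that the supremum [sup O] of the heights is attained: a certificate against
    it would bound all heights by a smaller number if [s > 0], and would contradict the existence of
    [c0] if [s = 0]. *)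
Lemma optimal_coef S om l x : cayley_sum S l x -> exists2 c, coef S l x c &
  forall c', coef S l x c' -> \sum_e c' e * om e <= \sum_e c e * om e.
Proof.
move=> [c0 xc0]; pose O : set R := [set r | exists2 c, coef S l x c & r = \sum_e c e * om e].
have hO : has_sup O.
  split; first by exists (\sum_e c0 e * om e), c0.
  exists (\sum_e l (g e) * `|om e|) => _ [c xc ->]; apply: ler_sum => e _.
  apply: le_trans (_ : c e * `|om e| <= _).
    by rewrite ler_wpM2l ?ler_norm//; case: xc.
  rewrite ler_wpM2r// -(coef_color xc) (bigD1 e)//= lerDl.
  by apply: sumr_ge0 => e' _; case: xc.
have supO c : coef S l x c -> \sum_e c e * om e <= sup O.
  by move=> xc; apply: ub_le_sup; [case: hO|exists c].
(* The extra generator [row3 0 0 (-1)] is a slack: it suffices to reach a height of at least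
   [sup O]. *)
have [[k [k0 kS]]|[y yS]] := farkas
    (fun o : E + 'I_1 => if o is inl e then e \in S else true)
    (fun o => if o is inl e then row3 (p e) (delta_mx 0 (g e)) (om e)
              else row3 0 0 (-1)) (row3 x (\row_i l i) (sup O)).
  pose k' := k \o inl.
  have -> : \sum_o k o *: (if o is inl e then row3 (p e) (delta_mx 0 (g e)) (om e)
      else row3 0 0 (-1)) = row3 (\sum_e k' e *: p e)
      (\sum_e k' e *: delta_mx 0 (g e)) (\sum_e k' e * om e - k (inr ord0)).
    rewrite big_sumType/= big_ord1 row3_sum /row3 !scale_row_mx !add_row_mx.
    rewrite !scaler0 !addr0; congr row_mx.
    by apply/matrixP => i j; rewrite !mxE mulrN1.
  move=> /row3_inj[xE /esym/color_delta_sum cl kO]; exists k'.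
    split => // e; first exact: k0.
    by move=> eS; apply: kS.
  move=> c' /supO /le_trans; apply; rewrite kO.
  by rewrite lerBlDr lerDl k0.
have [w [z [s yE]]] := row3E y; rewrite {}yE in yS *.
rewrite inner_row3 => xw.
have s0 : 0 <= s by have := yS (inr ord0) isT; rewrite inner_row3 !inner0l; lra.
have bound c : coef S l x c -> inner w x + \sum_i l i * z 0 i + s * (\sum_e c e * om e) <= 0.
  move=> xc; rewrite (coef_inner _ xc) -(color_sum _ (coef_color xc)) mulr_sumr.
  rewrite -!big_split; apply: sumr_le0 => e _ /=.
  have [eS|/(coef_supp xc)->] := boolP (e \in S); last by lra.
  have := yS (inl e) eS; rewrite inner_row3 innerC [X in _ + X + _]innerC inner_delta => h.
  have := mulr_ge0_le0 (coef_ge0 xc e) h; lra.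
have xwE : 0 < inner w x + \sum_i l i * z 0 i + s * sup O.
  move: xw; rewrite innerC mulrC; congr (_ < _ + _ + _).
  by apply: eq_bigr => i _; rewrite mxE.
have [s_gt0|s_le0] := ltP 0 s; last first.
  have sE : s = 0 by apply/eqP; rewrite eq_le s0 s_le0.
  by have := bound c0 xc0; move: xwE; rewrite sE; lra.
have : sup O <= - (inner w x + \sum_i l i * z 0 i) / s.
  apply: ge_sup; first by case: hO.
  move=> _ [c xc ->]; rewrite ler_pdivlMr//; have := bound c xc; lra.
by rewrite ler_pdivlMr//; move: xwE; lra.
Qed.

(* Linear programming duality: at an optimal representation of [x], the dual
   solution is the required [w]. *)
Lemma tight_cover S om l x : cayley_sum S l x -> exists w, cayley_sum (tight S om w) l x.
Proof.
move=> /(optimal_coef om)[c xc cmax].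
pose v e := row3 (p e) (delta_mx 0 (g e) : vec) (om e).
have [[k [k0 kP]]|[y yS]] := farkas
    (fun o : E + E => match o with inl e => e \in S | inr e => 0 < c e end)
    (fun o => match o with inl e => v e | inr e => - v e end)
    (row3 0 0 1).
  rewrite big_sumType/=; under [X in _ + X]eq_bigr do rewrite scalerN -scaleNr.
  rewrite -big_split/=; under eq_bigr do rewrite -scalerDl.
  pose d e := k (inl e) - k (inr e).
  rewrite row3_sum => /row3_inj[d0 dl dom].
  (* A step so small that [t * k (inr e) <= c e] for all [e]. Then [c + t d] is again a
     representation of [x], and its height exceeds the maximum by [t]. *)
  pose t : R := (1 + \sum_(e | 0 < c e) k (inr e) / c e)^-1.
  have den0 : 0 < 1 + \sum_(e | 0 < c e) k (inr e) / c e.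
    by rewrite ltr_wpDr// sumr_ge0// => e /ltW ce; rewrite divr_ge0.
  have t0 : 0 < t by rewrite invr_gt0.
  have xc' : coef S l x (fun e => c e + t * d e).
    split.
    - move=> e; rewrite /d mulrBr addrCA addr_ge0 ?mulr_ge0 ?(ltW t0)// subr_ge0.
      have [ce|ce] := boolP (0 < c e); last by rewrite (kP (inr e))// mulr0 (coef_ge0 xc).
      rewrite /t mulrC ler_pdivrMr// mulrDr mulr1 (bigD1 e)//= mulrDr.
      rewrite mulrCA mulfV ?gt_eqF// mulr1 addrCA lerDl addr_ge0 ?(coef_ge0 xc)//.
      rewrite mulr_ge0 ?(coef_ge0 xc)// sumr_ge0// => e' /andP[/ltW ce' _].
      by rewrite divr_ge0.
    - move=> e eS; have ce := coef_supp xc eS.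
      by rewrite ce /d (kP (inl e))// (kP (inr e)) ?ce ?ltxx// subrr mulr0 addr0.
    - move=> i; rewrite big_split/= (coef_color xc) -mulr_sumr.
      have := (color_delta_sum d (fun=> 0)).1; rewrite -dl.
      move=> ->; first by rewrite mulr0 addr0.
      by apply/rowP => j; rewrite !mxE.
    - under eq_bigr do rewrite scalerDl -scalerA.
      by rewrite big_split/= -scaler_sumr -d0 scaler0 addr0; case: xc.
  have := cmax _ xc'; under eq_bigr do rewrite mulrDl -mulrA.
  rewrite big_split/= -mulr_sumr -dom mulr1 gerDl leNgt t0//.
have [w [z [s yE]]] := row3E y; rewrite {}yE in yS *.
rewrite inner_row3 !inner0l !add0r mul1r => s0.
have ineq e : e \in S -> lifted om (s^-1 *: w) e <= - z 0 (g e) / s.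
  move=> eS; have := yS (inl e) eS.
  rewrite inner_row3 innerC [X in _ + X + _]innerC inner_delta => h.
  rewrite ler_pdivlMr// /lifted innerZl mulrDl mulrAC mulVf ?gt_eqF// mul1r; lra.
have tighte e : 0 < c e -> lifted om (s^-1 *: w) e = - z 0 (g e) / s.
  move=> ce; apply/eqP; rewrite eq_le ineq; last first.
    by apply: contraTT ce => /(coef_supp xc)->; rewrite ltxx.
  have := yS (inr e) ce.
  rewrite -scaleN1r innerZl inner_row3 innerC [X in _ * (_ + X + _)]innerC inner_delta => h.
  rewrite ler_pdivrMr// /lifted innerZl mulrDl mulrAC mulVf ?gt_eqF// mul1r; lra.
exists (s^-1 *: w), c; case: (xc) => c0 cS cl cx; split => // e eT.
apply/eqP; apply: contraNT eT => ce; rewrite inE.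
have ce0 : 0 < c e by rewrite lt_def ce c0.
have -> /= : e \in S by apply: contraNT ce => /cS->.
apply/forallP => e'; apply/implyP => e'S; apply/implyP => /eqP ge'.
by rewrite (tighte e)// -ge' ineq.
Qed.

(** Indexing by subsets rather than by vectors [w] leaves finitely many cells, each counted once. *)
Definition cells S om : pred {set E} := fun T => `[< exists w, T = tight S om w >].

(** At a point [x] of two cells, each of the two representations has at most the support value in
    the other direction. Hence their heights agree, and subtracting the two support equations puts
    [x] on the hyperplane with normal [w - w']. *)
Lemma volume_cells S om l : full S ->
  vol (cayley_sum S l) = (\sum_(T in cells S om) vol (cayley_sum T l))%E.
Proof.
move=> fS; rewrite -big_enum/= -volume_null_overlap ?enum_uniq//.
- congr (vol _); apply/seteqP; split=> [x /(tight_cover om)[w xw]|x [T]].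
    by exists (tight S om w) => //; rewrite mem_enum; apply/asboolP; exists w.
  by rewrite mem_enum => /asboolP[w ->]; apply: cayley_sum_sub; exact: tight_sub.
- by move=> T _; apply/measurable_separated/separated_cayley_sum.
move=> T T'; rewrite !mem_enum => /asboolP[w ->] /asboolP[w' ->] ww'.
have {}ww' : w - w' != 0.
  by apply: contra_neq ww' => /eqP; rewrite subr_eq0 => /eqP->.
have [r [rS rT]] := tight_value om w l fS; have [r' [rS' rT']] := tight_value om w' l fS.
apply: (@volume_null_sub _ _ _ [set x | inner (w - w') x = r - r']); last first.
  exact: volume_hyperplane.
move=> x [[c xc] [c' xc']] /=; rewrite innerBl.
have := rT _ _ xc; have := rT' _ _ xc'.
have := rS _ _ (coef_sub (tight_sub _ _ _) xc').
have := rS' _ _ (coef_sub (tight_sub _ _ _) xc).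
by lra.
Qed.

End Configuration.

(** * Mixed volumes of coloured point configurations *)

Section Coefficient.
Variables (R : realType) (n : nat).

Definition nodes : 'rV[R]_n.+2 := \row_k k%:R.

(* Interpolation weights on the nodes [0, ..., n + 1] that extract the linear
   coefficient of a polynomial. *)
Definition beta (k : 'I_n.+2) : R :=
  (invmx (Vandermonde n.+2 nodes) *m delta_mx (inord 1) 0 : 'cV_n.+2) k 0.

Lemma betaP (j : 'I_n.+2) : \sum_k beta k * k%:R ^+ j = (j == inord 1)%:R.
Proof.
have uV : Vandermonde n.+2 nodes \in unitmx.
  rewrite unitmxE unitfE det_Vandermonde; apply/prodf_neq0 => i _.
  apply/prodf_neq0 => k ik; rewrite !mxE subr_eq0 eqr_nat.
  by rewrite gtn_eqF.
have /matrixP/(_ j 0) := mulKVmx uV (delta_mx (inord 1) 0 : 'cV[R]_n.+2).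
rewrite [LHS]mxE [RHS]mxE eqxx andbT => <-; apply: eq_bigr => k _.
by rewrite mulrC; congr (_ * _); rewrite !mxE.
Qed.

(** The product of the one-variable functionals [beta] annihilates every monomial except the one
    with all exponents 1. *)
Lemma poly_eval_coef_ones (c : exps n -> R) :
  \sum_(k : {ffun 'I_n -> 'I_n.+2}) (\prod_i beta (k i)) *
    poly_eval c (fun i => (k i)%:R) = c (ones_exp n).
Proof.
transitivity (\sum_al c al * \prod_i (al i == inord 1)%:R); last first.
  rewrite (bigD1 (ones_exp n))//= big1; last by move=> i _; rewrite ffunE eqxx.
  rewrite mulr1 big1 ?addr0// => al al1.
  have [i ali] : exists i, al i != inord 1.
    apply/existsP; apply: contraNT al1; rewrite negb_exists => /forallP alN.
    by apply/eqP/ffunP => i; have := alN i; rewrite negbK ffunE => /eqP.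
  by rewrite (bigD1 i)//= (negPf ali) mul0r mulr0.
rewrite /poly_eval; under eq_bigr do rewrite mulr_sumr.
rewrite exchange_big/=; apply: eq_bigr => al _.
under [in RHS]eq_bigr do rewrite -betaP.
rewrite bigA_distr_bigA/= mulr_sumr; apply: eq_bigr => k _.
by rewrite mulrCA -big_split.
Qed.

End Coefficient.

Section Polynomial.
Variables (R : realType) (n' : nat) (E : finType).
Local Notation n := n'.+1.
Local Notation vec := 'rV[R]_n.
Local Notation vol := (@volume R n).
Variables (g : E -> 'I_n) (p : E -> vec).
Implicit Types (S T : {set E}) (l : 'I_n -> R) (c : E -> R) (w x : vec).
Local Notation cayley_sum := (cayley_sum g p).
Local Notation full := (full g).

(** * Sums of simplices with independent directions *)

Section Simplices.
Variables (S : {set E}) (b f : 'I_n -> E).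
Hypotheses (bS : forall i, b i \in S) (gb : forall i, g (b i) = i).
Hypotheses (fS : forall k, f k \in S) (f_inj : injective f).
Hypothesis fb : forall k i, f k != b i.
Hypothesis S_bf : forall e, e \in S -> e = b (g e) \/ exists k, e = f k.
Let M : 'M[R]_n := \matrix_k (p (f k) - p (b (g (f k)))).
Hypothesis uM : M \in unitmx.

Lemma sum_simplices (V : nmodType) (F : E -> V) : (forall e, e \notin S -> F e = 0) ->
  \sum_e F e = \sum_i F (b i) + \sum_k F (f k).
Proof.
move=> F0; pose h (o : 'I_n + 'I_n) := match o with inl i => b i | inr k => f k end.
have h_inj : injective h.
  case=> i [] j //= hij.
  - by rewrite -(gb i) hij gb.
  - by have := fb j i; rewrite hij eqxx.
  - by have := fb i j; rewrite hij eqxx.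
  - by rewrite (f_inj hij).
transitivity (\sum_(e in h @: finset.setT) F e).
  rewrite [RHS]big_mkcond; apply: eq_bigr => e _; case: imsetP => // eN.
  apply: F0; apply/negP => /S_bf[eb|[k ek]]; apply: eN.
    by exists (inl (g e)); rewrite ?inE.
  by exists (inr k); rewrite ?inE.
rewrite big_imset/=; last by move=> i j _ _; exact: h_inj.
by under eq_bigl do rewrite inE; rewrite big_sumType.
Qed.

(** The sum in coordinates along the edges from the base points [b i] to the remaining points [f k]:
    a product of simplices, one per colour and scaled by its weight. *)
Let Y l : set vec := [set y | (forall k, 0 <= y 0 k) /\
  forall i, \sum_(k | g (f k) == i) y 0 k <= l i].

Let t l : vec := \sum_i l i *: p (b i).

Lemma cayley_sum_simplices l : cayley_sum S l = [set t l + z | z in [set y *m M | y in Y l]].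
Proof.
have yM (y : vec) : y *m M = \sum_k y 0 k *: p (f k) -
    \sum_i (\sum_(k | g (f k) == i) y 0 k) *: p (b i).
  rewrite mulmx_sum_row; under eq_bigr do rewrite rowK scalerBr.
  rewrite sumrB; congr (_ - _).
  rewrite (partition_big (g \o f) xpredT)//=; apply: eq_bigr => i _.
  by rewrite scaler_suml; apply: eq_bigr => k /eqP->.
apply/seteqP; split=> [x [c [c0 cS cl ->]]|_ [_ [y [y0 yl] <-] <-]].
  pose y : vec := \row_k c (f k).
  have clE i : l i = c (b i) + \sum_(k | g (f k) == i) y 0 k.
    rewrite -cl big_mkcond/= sum_simplices; last by move=> e /cS->; case: ifP.
    rewrite (bigD1 i)//= gb eqxx big1 ?addr0; last first.
      by move=> j /negPf ji; rewrite gb ji.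
    by rewrite [in RHS]big_mkcond; congr (_ + _); apply: eq_bigr => k _; rewrite mxE.
  exists (y *m M).
    exists y => //; split=> [k|i]; first by rewrite mxE.
    by rewrite clE lerDr.
  rewrite yM sum_simplices; last by move=> e /cS->; rewrite scale0r.
  rewrite /t addrCA addrC; congr (_ + _).
    rewrite -sumrB; apply: eq_bigr => i _.
    by rewrite clE scalerDl addrK.
  by apply: eq_bigr => k _; rewrite mxE.
pose c e := (if e == b (g e) then l (g e) - \sum_(k | g (f k) == g e) y 0 k else 0) +
  \sum_k (if e == f k then y 0 k else 0).
have cb i : c (b i) = l i - \sum_(k | g (f k) == i) y 0 k.
  rewrite /c gb eqxx [X in _ + X]big1 ?addr0// => k _.
  by rewrite eq_sym (negPf (fb k i)).
have cf k : c (f k) = y 0 k.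
  rewrite /c (negPf (fb _ _)) add0r (bigD1 k)//= eqxx big1 ?addr0// => j jk.
  by rewrite (inj_eq f_inj) eq_sym (negPf jk).
have cS e : e \notin S -> c e = 0.
  move=> eS; rewrite /c; case: eqP => [eb|_]; first by rewrite eb bS in eS.
  rewrite add0r big1// => k _; case: eqP => // ek.
  by rewrite ek fS in eS.
exists c; split => //.
- move=> e; have [/S_bf[->|[k ->]]|/cS->//] := boolP (e \in S).
    by rewrite cb subr_ge0.
  by rewrite cf.
- move=> i; rewrite big_mkcond/= sum_simplices; last by move=> e /cS->; case: ifP.
  rewrite (bigD1 i)//= gb eqxx big1 ?addr0; last first.
    by move=> j /negPf ji; rewrite gb ji.
  rewrite cb -big_mkcond/=; under [X in _ + X]eq_bigr do rewrite cf.
  by rewrite subrK.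
- rewrite yM sum_simplices; last by move=> e /cS->; rewrite scale0r.
  rewrite /t addrCA addrC; congr (_ + _).
    by rewrite -sumrB; apply: eq_bigr => i _; rewrite cb scalerBl.
  by apply: eq_bigr => k _; rewrite cf.
Qed.

Lemma separated_simplices l : separated (Y l).
Proof.
move=> y /not_andP[/existsNP[k /negP]|/existsNP[i /negP]]; rewrite -ltNge => yk.
  exists (-1 *: delta_mx 0 k), 0; rewrite innerZl innerC inner_delta; split.
    by rewrite mulN1r oppr_gt0.
  move=> z [z0 _] /=; rewrite innerZl innerC inner_delta mulN1r oppr_le0.
  exact: z0.
pose u : vec := \row_k (g (f k) == i)%:R.
have uE z : inner u z = \sum_(k | g (f k) == i) z 0 k.
  rewrite big_mkcond; apply: eq_bigr => k _; rewrite mxE.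
  by case: ifP => _; rewrite ?mul1r ?mul0r.
by exists u, (l i); rewrite uE; split => // z [_ zl] /=; rewrite uE.
Qed.

Lemma simplices_bounded l : Y l `<=` box 0 (\row_k l (g (f k))).
Proof.
move=> y [y0 yl] k; rewrite !mxE y0/=; apply: le_trans (yl _).
by rewrite (bigD1 k)//= lerDl sumr_ge0.
Qed.

Lemma volume_unit_simplices : exists2 C : R, 0 < C & vol (Y (fun=> 1)) = C%:E.
Proof.
have Yfin : vol (Y (fun=> 1)) \is a fin_num.
  rewrite ge0_fin_numE ?volume_ge0//.
  exact: volume_box_lt_oo (@simplices_bounded _).
exists (fine (vol (Y (fun=> 1)))); last by rewrite fineK.
rewrite -lte_fin fineK//.
(* At most [n] coordinates are added up for one colour, so side length [1/n] suffices. *)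
have sub : box 0 (const_mx n%:R^-1) `<=` Y (fun=> 1).
  move=> y yn; split=> [k|i]; first by have := yn k; rewrite mxE => /andP[].
  apply: le_trans (_ : \sum_(k < n) n%:R^-1 <= 1); last first.
    by rewrite sumr_const card_ord -[_^-1 *+ _]mulr_natl mulfV// pnatr_eq0.
  rewrite big_mkcond/=; apply: ler_sum => k _; have := yn k; rewrite !mxE.
  by case: ifP => _ /andP[// _ _]; rewrite invr_ge0.
apply: lt_le_trans (le_volume sub); rewrite volume_box lte_fin.
by apply: prodr_gt0 => k _; rewrite !mxE subr0 lt_max invr_gt0 ltr0n.
Qed.

(** Scaling the [k]-th coordinate by the weight of the colour of [f k] maps the unit product to
    [Y l]. If one of these weights is 0 the scaling degenerates, but then [Y l] lies in a coordinate
    hyperplane and both sides vanish. *)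
Lemma volume_simplices : exists2 C : R, 0 < C & forall l, (forall i, 0 <= l i) ->
  vol (cayley_sum S l) = (C * \prod_k l (g (f k)))%:E.
Proof.
have [C1 C10 C1E] := volume_unit_simplices; have [C2 C20 C2E] := volume_mulmx uM.
exists (C2 * C1) => [|l l0]; first exact: mulr_gt0.
rewrite cayley_sum_simplices volume_translate (C2E _ _ _ (@separated_simplices l) (@simplices_bounded l)).
rewrite -mulrA EFinM; congr (_ * _)%E.
have [l_gt0|/existsNP[k /negP]] := pselect (forall k, 0 < l (g (f k))); last first.
  rewrite -leNgt => lk; have {}lk : l (g (f k)) = 0 by apply/eqP; rewrite eq_le lk l0.
  rewrite (bigD1 k)//= lk mul0r mulr0.
  apply: (@volume_null_sub _ _ _ [set y | inner (delta_mx 0 k) y = 0]); last first.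
    by apply: volume_hyperplane; apply/eqP => /matrixP/(_ 0 k)/eqP; rewrite !mxE !eqxx oner_eq0.
  move=> y /simplices_bounded/(_ k) /=; rewrite innerC inner_delta !mxE lk.
  by move=> /le_anti.
rewrite mulrC EFinM -C1E -volume_rescale//; congr (vol _).
apply/seteqP; split=> [y [y0 yl]|_ [y [y0 yl] <-]].
  exists (rescale (fun k => (l (g (f k)))^-1) y); last first.
    by apply/rowP => j; rewrite !mxE mulVKf// gt_eqF.
  split=> [j|i]; first by rewrite mxE mulr_ge0// invr_ge0.
  have [/existsP[j /eqP gj]|/existsPn Nj] := boolP [exists j, g (f j) == i].
    under eq_bigr => m /eqP gm do rewrite mxE gm.
    by rewrite -mulr_sumr mulrC ler_pdivrMr ?mul1r// -gj.
  by rewrite big_pred0// => j; apply/negbTE.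
split=> [j|i]; first by rewrite mxE mulr_ge0.
under eq_bigr => m /eqP gm do rewrite mxE gm.
by rewrite -mulr_sumr -[leRHS]mulr1 ler_wpM2l.
Qed.

End Simplices.

Definition transversal S := exists a b : 'I_n -> E,
  (forall i, [/\ a i \in S, b i \in S, g (a i) = i & g (b i) = i]) /\
  row_free (\matrix_i (p (b i) - p (a i))).

(* Affine independence of each colour class together with linear independence
   of their directions, i.e. of the columns of the Cayley configuration. *)
Definition cayley_free S := forall c, (forall e, e \notin S -> c e = 0) ->
  (forall i, \sum_(e | g e == i) c e = 0) -> \sum_e c e *: p e = 0 ->
  forall e, c e = 0.

(** A relation [y] among the differences is a relation of the configuration. Since the [a k] are
    distinct and differ from all [b j], the coefficient at [a k] is exactly [y 0 k]. *)
Lemma cayley_free_directions S (m : nat) (a b : 'I_m -> E) : cayley_free S ->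
  (forall k, [/\ a k \in S, b k \in S & g (a k) = g (b k)]) ->
  injective a -> (forall k j, a k != b j) ->
  row_free (\matrix_k (p (a k) - p (b k))).
Proof.
move=> freeS abS a_inj ab; apply: inj_row_free => y yM.
pose c e := \sum_k y 0 k * ((e == a k)%:R - (e == b k)%:R).
have sumc (V : lmodType R) (F : E -> V) :
    \sum_e c e *: F e = \sum_k y 0 k *: (F (a k) - F (b k)).
  under eq_bigr do rewrite scaler_suml.
  rewrite exchange_big/=; apply: eq_bigr => k _.
  under eq_bigr do rewrite -scalerA scalerBl.
  rewrite -scaler_sumr sumrB; congr (_ *: (_ - _)).
    by rewrite (bigD1 (a k))//= eqxx scale1r big1 ?addr0// => e /negPf->; rewrite scale0r.
  by rewrite (bigD1 (b k))//= eqxx scale1r big1 ?addr0// => e /negPf->; rewrite scale0r.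
have c0 : forall e, c e = 0.
  apply: freeS.
  - move=> e eS; apply: big1 => k _; have [akS bkS _] := abS k.
    have /negPf-> : e != a k by apply: contraNneq eS => ->.
    have /negPf-> : e != b k by apply: contraNneq eS => ->.
    by rewrite subrr mulr0.
  - move=> i; have := sumc R^o (fun e => (g e == i)%:R).
    rewrite [X in _ = X -> _]big1; last first.
      by move=> k _; have [_ _ ->] := abS k; rewrite subrr scaler0.
    move=> sc; rewrite -[RHS]sc [LHS]big_mkcond/=; apply: eq_bigr => e _.
    by case: ifP => _; rewrite /GRing.scale/= ?mulr1 ?mulr0.
  - rewrite sumc; move: yM; rewrite mulmx_sum_row => yM; rewrite -[RHS]yM.
    by apply: eq_bigr => k _; rewrite rowK.
apply/rowP => k; rewrite mxE -(c0 (a k)) /c (bigD1 k)//= eqxx (negPf (ab _ _)).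
rewrite subr0 mulr1 big1 ?addr0// => j jk.
by rewrite (inj_eq a_inj) eq_sym (negPf jk) (negPf (ab _ _)) subrr mulr0.
Qed.

Lemma full_choice S : full S ->
  exists b : 'I_n -> E, forall i, b i \in S /\ g (b i) = i.
Proof.
move=> fS; have ex i : exists e, e \in S /\ g e = i by have [e] := fS i; exists e.
by have [b bP] := choice ex; exists b.
Qed.

Lemma volume_cayley_sum_flat S l u : full S -> u != 0 -> (forall e e', e \in S -> e' \in S ->
  g e = g e' -> inner u (p e) = inner u (p e')) -> vol (cayley_sum S l) = 0%E.
Proof.
move=> fS u0 flat; have [b bP] := full_choice fS.
apply: (@volume_null_sub _ _ _ [set x | inner u x = \sum_i l i * inner u (p (b i))]).
  move=> x [c xc] /=; rewrite (coef_inner _ xc).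
  rewrite -(color_sum (fun i => inner u (p (b i))) (coef_color xc)).
  apply: eq_bigr => e _; have [eS|/(coef_supp xc)->] := boolP (e \in S); last by rewrite !mul0r.
  by have [bS gb] := bP (g e); rewrite (flat e (b (g e))).
exact: volume_hyperplane.
Qed.

Definition cayley_polynomial S (c : exps n -> R) := forall l, (forall i, 0 <= l i) ->
  vol (cayley_sum S l) = (poly_eval c l)%:E.

(** Besides one base point per colour, independence leaves at most [n] points. With fewer than [n]
    the sum is flat and the polynomial is 0. With [n] it is a monomial whose exponents count these
    points by colour; all exponents are 1 exactly when every colour has one, and then each colour
    provides a segment. *)
Lemma cayley_polynomial_free S : full S -> cayley_free S -> exists c : exps n -> R,
  [/\ cayley_polynomial S c, 0 <= c (ones_exp n) & 0 < c (ones_exp n) -> transversal S].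
Proof.
move=> fS freeS; have [b bP] := full_choice fS.
have bS i := (bP i).1; have gb i := (bP i).2.
pose D := [set e in S | e != b (g e)]%SET.
pose q (k : 'I_#|D|) : E := enum_val k.
have qD k : (q k \in S) /\ (q k != b (g (q k))).
  by have := enum_valP k; rewrite inE => /andP.
have qb k i : q k != b i.
  by apply: contraNneq (qD k).2 => qi; rewrite qi gb.
have Mfree : row_free (\matrix_k (p (q k) - p (b (g (q k))))).
  apply: (cayley_free_directions freeS); last 2 first.
  - exact: enum_val_inj.
  - by move=> k j; exact: qb.
  by move=> k; rewrite gb bS; split => //; exact: (qD k).1.
have [cardD|] := eqVneq #|D| n; last first.
  rewrite neq_ltn => /orP[ltD|]; last first.
    by move: Mfree => /eqP <-; rewrite ltnNge rank_leq_col.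
  exists (fun=> 0); split => //; last by rewrite ltxx.
  move=> l l0; rewrite /poly_eval big1; last by move=> al _; rewrite mul0r.
  set M := \matrix_k _ in Mfree.
  have kM : kermx M^T != 0.
    rewrite kermx_eq0 /row_free mxrank_tr; apply/eqP => rM.
    by have := rank_leq_row M; rewrite rM leqNgt ltD.
  have uM : nz_row (kermx M^T) *m M^T = 0.
    by apply/eqP; rewrite -sub_kermx nz_row_sub.
  have flat e : e \in S -> inner (nz_row (kermx M^T)) (p e) =
      inner (nz_row (kermx M^T)) (p (b (g e))).
    move=> eS; have [<-//|eb] := eqVneq e (b (g e)).
    have eD : e \in D by rewrite inE eS eb.
    move/matrixP/(_ 0 (enum_rank_in eD e)): uM; rewrite !mxE => uM.
    apply/eqP; rewrite -subr_eq0 -innerBr -uM; apply/eqP; apply: eq_bigr => j _.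
    by rewrite !mxE /q enum_rankK_in.
  apply: (@volume_cayley_sum_flat S l (nz_row (kermx M^T))) => //; first by rewrite nz_row_eq0.
  by move=> e e' eS e'S gee'; rewrite (flat e)// (flat e')// gee'.
pose f k := q (cast_ord (esym cardD) k).
have fqb k i : f k != b i by exact: qb.
have f_inj : injective f by move=> k j /enum_val_inj/cast_ord_inj.
have uM : (\matrix_k (p (f k) - p (b (g (f k)))) : 'M[R]_n) \in unitmx.
  rewrite -row_free_unit; apply: (cayley_free_directions freeS _ f_inj).
  + by move=> k; rewrite gb bS; split => //; exact: (qD _).1.
  + by move=> k j; exact: qb.
have S_bf e : e \in S -> e = b (g e) \/ exists k, e = f k.
  move=> eS; have [->|eb] := eqVneq e (b (g e)); first by rewrite gb; left.
  have eD : e \in D by rewrite inE eS eb.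
  right; exists (cast_ord cardD (enum_rank_in eD e)).
  by rewrite /f /q cast_ordK enum_rankK_in.
have [C C0 CE] := volume_simplices bS gb (fun k => (qD _).1) f_inj fqb S_bf uM.
pose d i := #|[pred k | g (f k) == i]|.
have dn i : (d i < n.+2)%N by rewrite ltnW// ltnS ltnS -[leqRHS]card_ord max_card.
pose al : exps n := [ffun i => inord (d i)].
exists (fun a => if a == al then C else 0); split.
- move=> l l0; rewrite CE// /poly_eval (bigD1 al)//= eqxx [X in _ + X]big1 ?addr0; last first.
    by move=> a /negPf->; rewrite mul0r.
  congr (_ * _)%:E; rewrite (partition_big (g \o f) xpredT)//=.
  apply: eq_bigr => i _; rewrite ffunE inordK// -prodr_const.
  by apply: eq_bigr => k /eqP->.
- by case: ifP => // _; rewrite ltW.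
- case: eqP; last by rewrite ltxx.
  move=> ones _; have ex i : exists k, g (f k) = i.
    have /card_gt0P[k] : (0 < d i)%N; last by rewrite inE => /eqP; exists k.
    have := congr1 (fun a : exps n => nat_of_ord (a i)) ones.
    by rewrite /= !ffunE !inordK// => <-.
  have [h hP] := choice ex; exists b, (f \o h); split.
    by move=> i; rewrite /= bS gb hP; split => //; exact: (qD _).1.
  apply: (cayley_free_directions freeS) => [i|i j /f_inj hij|i j].
  + by rewrite /= hP bS gb; split => //; exact: (qD _).1.
  + by rewrite -(hP i) hij hP.
  + exact: qb.
Qed.

Lemma transversal_sub S T : S \subset T -> transversal S -> transversal T.
Proof.
move=> /fintype.subsetP ST [a [b [abS fr]]]; exists a, b; split => // i.
by have [aS bS ga gb] := abS i; rewrite !ST.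
Qed.

(* A dependency of the Cayley configuration is destroyed by raising one point
   of its support, so all cells of that subdivision are smaller. *)
Lemma cayley_polynomialP S : full S -> exists c : exps n -> R,
  [/\ cayley_polynomial S c, 0 <= c (ones_exp n) & 0 < c (ones_exp n) -> transversal S].
Proof.
have [N] := ubnP #|S|; elim: N S => // N IHN S; rewrite ltnS => SN fS.
have [freeS|/existsNP[d]] := pselect (cayley_free S); first exact: cayley_polynomial_free.
move=> /not_implyP[dS /not_implyP[dl /not_implyP[dp /existsNP[k /eqP dk]]]].
pose om (e : E) : R := (e == k)%:R.
have small w : (#|tight g p S om w| < N)%N.
  apply: leq_trans SN; apply: proper_card; rewrite finset.properEneq tight_sub andbT.
  apply/eqP => tS; have [z [_ zT]] := tight_max p om w fS.
  (* If the cell were all of [S], lifted values would depend on the colour only and pair to 0 with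
     the relation [d]. But [d] also annihilates the part linear in [p], which leaves [d k], the
     contribution of the raised point. *)
  have : \sum_e d e * lifted p om w e = \sum_e d e * z (g e).
    apply: eq_bigr => e _; have [eS|/dS->] := boolP (e \in S); last by rewrite !mul0r.
    by move: (zT e); rewrite tS eS => /esym/eqP->.
  rewrite (color_sum z dl) [RHS]big1; last by move=> i _; rewrite mul0r.
  under eq_bigr do rewrite mulrDr -innerZr; rewrite big_split/= -inner_sumr dp inner0r add0r.
  rewrite (bigD1 k)//= /om eqxx mulr1 big1 ?addr0; last first.
    by move=> e /negPf->; rewrite mulr0.
  by move/eqP; rewrite (negPf dk).
have IH T : exists c : exps n -> R, T \in cells g p S om ->
    [/\ cayley_polynomial T c, 0 <= c (ones_exp n) & 0 < c (ones_exp n) -> transversal T].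
  have [/asboolP[w ->]|] := boolP (T \in cells g p S om); last by exists (fun=> 0).
  by have [c cP] := IHN _ (small w) (tight_full p om w fS); exists c.
have {IH}[c cP] := choice IH.
exists (fun a => \sum_(T in cells g p S om) c T a); split.
- move=> l l0; rewrite (volume_cells p om l fS) /poly_eval.
  under [in RHS]eq_bigr do rewrite mulr_suml.
  rewrite exchange_big/= -sumEFin; apply: eq_bigr => T Tc.
  by have [-> //] := cP T Tc.
- by apply: sumr_ge0 => T /cP[].
- move=> c0; have [T Tc cT] : exists2 T, T \in cells g p S om & 0 < c T (ones_exp n).
    apply: contrapT => NT; move: c0; rewrite ltNge sumr_le0// => T Tc.
    by rewrite leNgt; apply/negP => cT; apply: NT; exists T.
  have [_ _ /(_ cT)] := cP T Tc; apply: transversal_sub.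
  by move: Tc => /asboolP[w ->]; exact: tight_sub.
Qed.

(** The coefficient is recovered from the volumes at integer weights, so that it is defined for each
    [S] and inherits additivity term by term. *)
Definition cayley_mv S : R := \sum_(k : {ffun 'I_n -> 'I_n.+2}) (\prod_i beta R (k i)) *
  fine (vol (cayley_sum S (fun i => (k i)%:R))).

Lemma cayley_mv_coef S (c : exps n -> R) : cayley_polynomial S c -> cayley_mv S = c (ones_exp n).
Proof.
move=> Sc; rewrite -poly_eval_coef_ones; apply: eq_bigr => k _.
by rewrite Sc.
Qed.

Lemma cayley_mv_ge0 S : full S -> 0 <= cayley_mv S.
Proof. by move=> /cayley_polynomialP[c [/cayley_mv_coef->]]. Qed.

Lemma cayley_mv_gt0_transversal S : full S -> 0 < cayley_mv S -> transversal S.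
Proof. by move=> /cayley_polynomialP[c [/cayley_mv_coef->]]. Qed.

Lemma cayley_mv_cells S om : full S -> cayley_mv S = \sum_(T in cells g p S om) cayley_mv T.
Proof.
move=> fS; rewrite exchange_big/=; apply: eq_bigr => k _.
rewrite (volume_cells p om _ fS) -mulr_sumr; congr (_ * _).
have finT T : T \in cells g p S om -> vol (cayley_sum T (fun i => (k i)%:R)) \is a fin_num.
  by move=> _; exact: volume_cayley_sum_fin.
rewrite -(eq_bigr _ (fun T Tc => fineK (finT T Tc))) sumEFin.
by [].
Qed.

(** The source of strict inequalities: a second cell with positive mixed volume separates the first
    one from the whole. *)
Lemma cayley_mv_tight S om w w' : full S -> tight g p S om w != tight g p S om w' ->
  cayley_mv (tight g p S om w) + cayley_mv (tight g p S om w') <= cayley_mv S.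
Proof.
move=> fS ww'; rewrite (cayley_mv_cells om fS).
have cell u : tight g p S om u \in cells g p S om by apply/asboolP; exists u.
rewrite (bigD1 (tight g p S om w)) ?cell//= lerD2l (bigD1 (tight g p S om w')).
  rewrite lerDl sumr_ge0// => T /andP[/andP[/asboolP[u ->] _] _].
  exact/cayley_mv_ge0/tight_full.
by rewrite cell eq_sym.
Qed.

Lemma full_sub S T : S \subset T -> full S -> full T.
Proof.
by move=> /fintype.subsetP ST fS i; have [e /ST] := fS i; exists e.
Qed.

Lemma tight0 S T om : T \subset S -> full T -> (forall e, e \in T -> om e = 0) ->
  (forall e, e \in S -> e \notin T -> om e < 0) -> tight g p S om 0 = T.
Proof.
move=> /fintype.subsetP TS fT om0 omN; apply/setP => e; rewrite inE.
have lE e' : lifted p om 0 e' = om e' by rewrite /lifted inner0l add0r.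
apply/andP/idP => [[eS /forallP et]|eT].
  apply: contraT => eT; have [e' e'T ge'] := fT (g e).
  have := et e'; rewrite TS// ge' eqxx/= !lE om0//.
  by rewrite leNgt omN.
split; first exact: TS.
apply/forallP => e'; apply/implyP => e'S; apply/implyP => _; rewrite !lE (om0 e)//.
by have [/om0->//|/(omN _ e'S)/ltW] := boolP (e' \in T).
Qed.

(** Lowering the points outside [T] makes [T] itself a cell, and the other cells contribute
    nonnegatively. *)
Lemma le_cayley_mv S T : T \subset S -> full T -> cayley_mv T <= cayley_mv S.
Proof.
move=> TS fT; have fS := full_sub TS fT; pose om (e : E) : R := if e \in T then 0 else -1.
have t0 : tight g p S om 0 = T.
  apply: tight0 => // e; rewrite /om; first by move=> ->.
  by move=> _ /negPf->; rewrite oppr_lt0.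
rewrite (cayley_mv_cells om fS) (bigD1 T); last by apply/asboolP; exists 0.
rewrite lerDl sumr_ge0// => T' /andP[/asboolP[u ->] _].
exact/cayley_mv_ge0/tight_full.
Qed.

(** By monotonicity only the [n] segments need be kept; their weighted sum is a parallelepiped,
    whose volume is a positive multiple of the product of the weights. *)
Lemma transversal_cayley_mv_gt0 S : transversal S -> 0 < cayley_mv S.
Proof.
move=> [a [b [abS frM]]].
have aS i : a i \in S by have [] := abS i.
have bS i : b i \in S by have [] := abS i.
have ga i : g (a i) = i by have [] := abS i.
have gb i : g (b i) = i by have [] := abS i.
have ba i j : b i != a j.
  apply: contraTneq frM => bij; have ij : i = j by rewrite -(gb i) bij ga.
  apply/negP => /row_freeP[B /(congr1 (row i))]; rewrite row_mul rowK -ij in bij *.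
  rewrite ij -ij bij subrr mul0mx => /rowP/(_ i); rewrite !mxE eqxx => /esym/eqP.
  by rewrite oner_eq0.
pose S0 := ([set a i | i in 'I_n] :|: [set b i | i in 'I_n])%SET.
have aS0 i : a i \in S0 by rewrite inE imset_f.
have bS0 i : b i \in S0 by rewrite inE orbC imset_f.
have fS0 : full S0 by move=> i; exists (a i).
have S0S : S0 \subset S.
  by apply/fintype.subsetP => e /setUP[] /imsetP[i _ ->].
apply: lt_le_trans (le_cayley_mv S0S fS0).
have b_inj : injective b by move=> i j bij; rewrite -(gb i) bij gb.
have S0_ab e : e \in S0 -> e = a (g e) \/ exists k, e = b k.
  by case/setUP => /imsetP[i _ ->]; [left; rewrite ga|right; exists i].
have uM : (\matrix_k (p (b k) - p (a (g (b k)))) : 'M[R]_n) \in unitmx.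
  rewrite -row_free_unit; move: frM; congr row_free.
  by apply/matrixP => i j; rewrite !mxE gb.
have [C C0 CE] := volume_simplices aS0 ga bS0 b_inj ba S0_ab uM.
rewrite (@cayley_mv_coef _ (fun al => if al == ones_exp n then C else 0)) ?eqxx//.
move=> l l0; rewrite CE// /poly_eval (bigD1 (ones_exp n))//= eqxx [X in _ + X]big1 ?addr0; last first.
  by move=> al /negPf->; rewrite mul0r.
congr (_ * _)%:E; apply: eq_bigr => i _.
by rewrite gb ffunE inordK// expr1.
Qed.

End Polynomial.

(** * From polytopes to coloured configurations *)

Section Hull.
Variables (R : realType) (n' : nat) (E : finType).
Local Notation n := n'.+1.
Local Notation vec := 'rV[R]_n.
Variables (g : E -> 'I_n) (p : E -> vec).
Implicit Types (S T : {set E}) (l : 'I_n -> R) (c : E -> R) (x : vec) (i : 'I_n).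

Definition hull S i : set vec := [set x | exists c, [/\ forall e, 0 <= c e,
  forall e, ~~ ((e \in S) && (g e == i)) -> c e = 0, \sum_e c e = 1 &
  x = \sum_e c e *: p e]].

Lemma msum_hull S l : full g S -> (forall i, 0 <= l i) ->
  Defs.msum finset.setT (fun i => dilate (l i) (hull S i)) = cayley_sum g p S l.
Proof.
move=> fS l0; apply/seteqP; split=> [x [y [yK ->]]|x [c [c0 cS cl ->]]].
  have ex i : exists c, [/\ forall e, 0 <= c e,
      forall e, ~~ ((e \in S) && (g e == i)) -> c e = 0, \sum_e c e = 1 &
      y i = l i *: \sum_e c e *: p e].
    by have [|_ [c [c0 cS c1 ->]] <-] := yK i; [rewrite inE|exists c].
  have [c cP] := choice ex.
  have ciE i j e : g e == i -> i != j -> c j e = 0.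
    move=> /eqP gi ij; have [_ -> //] := cP j.
    by rewrite gi (negPf ij) andbF.
  exists (fun e => l (g e) * c (g e) e); split.
  - by move=> e; have [cge0 _ _ _] := cP (g e); rewrite mulr_ge0.
  - by move=> e /negPf eS; have [_ -> //] := cP (g e); rewrite ?mulr0// eS.
  - move=> i; have [_ cS c1 _] := cP i; rewrite -[RHS]mulr1 -c1 mulr_sumr big_mkcond/=.
    apply: eq_bigr => e _; case: eqP => [->//|/eqP ge].
    by rewrite cS ?mulr0// (negPf ge) andbF.
  - rewrite (partition_big g xpredT)//=; apply: eq_big => [i|i _]; first by rewrite inE.
    have [_ cS _ ->] := cP i; rewrite scaler_sumr [RHS]big_mkcond/=.
    apply: eq_bigr => e _; case: eqP => [<-|/eqP ge]; first by rewrite scalerA.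
    by rewrite cS ?scale0r ?scaler0// (negPf ge) andbF.
exists (fun i => \sum_(e | g e == i) c e *: p e); split; last first.
  by rewrite (partition_big g xpredT)//=; apply: eq_bigl => i; rewrite inE.
(* Coefficients of total weight 0 cannot be normalised; any point of the colour serves instead, and
   [full] supplies one. *)
move=> i _; have [li|li] := eqVneq (l i) 0.
  have [e0 e0S ge0] := fS i; exists (p e0).
    exists (fun e => (e == e0)%:R); split => //.
    - move=> e; apply: contraNeq; rewrite pnatr_eq0 eqb0 negbK => /eqP->.
      by rewrite e0S ge0 eqxx.
    - by rewrite (bigD1 e0)//= eqxx big1 ?addr0// => e /negPf->.
    - rewrite (bigD1 e0)//= eqxx scale1r big1 ?addr0// => e /negPf->.
      by rewrite scale0r.
  rewrite li scale0r big1// => e ge.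
  have /psumr_eq0P : \sum_(e | g e == i) c e = 0 by rewrite cl.
  by move=> ->//; rewrite scale0r.
exists ((l i)^-1 *: \sum_(e | g e == i) c e *: p e); last first.
  by rewrite scalerA mulfV// scale1r.
exists (fun e => if g e == i then (l i)^-1 * c e else 0); split.
- by move=> e; case: ifP => // _; rewrite mulr_ge0// invr_ge0.
- move=> e; case: ifP => // _; rewrite andbT => /cS->.
  by rewrite mulr0.
- by rewrite -big_mkcond/= -mulr_sumr cl mulVf.
- rewrite scaler_sumr big_mkcond/=; apply: eq_bigr => e _.
  by case: ifP => _; rewrite ?scale0r// scalerA.
Qed.

(** [xget] is determined because every polynomial representing the volume has the same coefficient,
    the one that [cayley_mv] computes from its values. *)
Lemma mixed_volume_hull S (K : 'I_n -> set vec) : full g S ->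
  (forall i, K i = hull S i) -> mixed_volume K = cayley_mv g p S.
Proof.
move=> fS KE; have {}KE : K = hull S by apply/funext.
have rep (c : exps n -> R) : (forall l, (forall i, 0 <= l i) ->
    volume (Defs.msum finset.setT (fun i => dilate (l i) (K i))) = (poly_eval c l)%:E) <->
    cayley_polynomial g p S c.
  by split=> cP l l0; have := cP l l0; rewrite KE msum_hull.
have [c [Sc _ _]] := cayley_polynomialP p fS.
apply: xget_unique; first by exists c; split; [exact/rep|exact: cayley_mv_coef].
by move=> v [c' [/rep Sc' ->]]; rewrite (cayley_mv_coef Sc').
Qed.

End Hull.

Section Conv.
Variables (R : realType) (n : nat).
Local Notation vec := 'rV[R]_n.
Implicit Types (s : seq vec) (x y u : vec).

Lemma conv_mem s x : x \in s -> conv s x.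
Proof.
move=> xs; have k : (index x s < size s)%N by rewrite index_mem.
exists (fun i => (i == Ordinal k)%:R); split => //.
  by rewrite (bigD1 (Ordinal k))//= eqxx big1 ?addr0// => i /negPf->.
rewrite (bigD1 (Ordinal k))//= eqxx scale1r nth_index// big1 ?addr0// => i /negPf->.
by rewrite scale0r.
Qed.

Lemma conv_convex (I : finType) (c : I -> R) (q : I -> vec) s :
  (forall i, 0 <= c i) -> \sum_i c i = 1 -> (forall i, c i != 0 -> conv s (q i)) ->
  conv s (\sum_i c i *: q i).
Proof.
move=> c0 c1 qs.
have ex i : exists w : 'I_(size s) -> R, c i != 0 -> [/\ forall k, 0 <= w k,
    \sum_k w k = 1 & q i = \sum_k w k *: s`_k].
  by have [ci|/qs[w wP]] := eqVneq (c i) 0; [exists (fun=> 0)|exists w].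
have [w wP] := choice ex; exists (fun k => \sum_i c i * w i k); split.
- move=> k; apply: sumr_ge0 => i _; have [->|/wP[wi _ _]] := eqVneq (c i) 0.
    by rewrite mul0r.
  by rewrite mulr_ge0.
- rewrite exchange_big/= -c1; apply: eq_bigr => i _; rewrite -mulr_sumr.
  by have [->|/wP[_ -> _]] := eqVneq (c i) 0; rewrite ?mul0r ?mulr1.
- under [RHS]eq_bigr do rewrite scaler_suml.
  rewrite exchange_big/=; apply: eq_bigr => i _; under eq_bigr do rewrite -scalerA.
  rewrite -scaler_sumr; have [->|/wP[_ _ ->]] := eqVneq (c i) 0 => //.
  by rewrite !scale0r.
Qed.

Lemma conv_seg s x y (d : R) : 0 <= d <= 1 -> conv s x -> conv s y ->
  conv s (x + d *: (y - x)).
Proof.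
move=> /andP[d0 d1] sx sy.
have := @conv_convex bool (fun b => if b then d else 1 - d) (fun b => if b then y else x) s.
rewrite !big_bool/= => h; have -> : x + d *: (y - x) = d *: y + (1 - d) *: x.
  by rewrite scalerBr scalerBl scale1r addrCA.
apply: h => [[]||[]] //; first by rewrite subr_ge0.
by rewrite addrC subrK.
Qed.

Lemma conv_max s u : s != [::] ->
  exists2 x, x \in s & forall y, conv s y -> inner u y <= inner u x.
Proof.
move=> s0; have [x xs xmax] : exists2 x, x \in s & forall y, y \in s -> inner u y <= inner u x.
  elim: s s0 => // z s IHs _; have [->|/IHs[x xs xmax]] := eqVneq s [::].
    by exists z; rewrite ?inE// => y; rewrite inE => /eqP->.
  have [zx|xz] := leP (inner u z) (inner u x).
    exists x; first by rewrite inE xs orbT.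
    by move=> y; rewrite inE => /orP[/eqP->//|]; exact: xmax.
  exists z; first by rewrite inE eqxx.
  by move=> y; rewrite inE => /orP[/eqP->//|/xmax/le_trans]; apply; exact: ltW.
exists x => // y [w [w0 w1 ->]]; rewrite inner_sumr -[leRHS]mul1r -w1 mulr_suml.
by apply: ler_sum => k _; rewrite innerZr ler_wpM2l// xmax// mem_nth// ltn_ord.
Qed.

End Conv.

Lemma hull_conv (R : realType) (n' : nat) (E : finType) (g : E -> 'I_n'.+1)
    (p : E -> 'rV[R]_n'.+1) (S : {set E}) (i : 'I_n'.+1) (s : seq 'rV[R]_n'.+1) :
  (forall e, e \in S -> g e = i -> conv s (p e)) ->
  (forall x, x \in s -> exists e, [/\ e \in S, g e = i & p e = x]) ->
  hull g p S i = conv s.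
Proof.
move=> Ss sS; apply/seteqP; split=> [x [c [c0 cS c1 ->]]|x [w [w0 w1 ->]]].
  apply: conv_convex => // e ce.
  have /andP[eS /eqP ge] : (e \in S) && (g e == i) by apply: contraNT ce => /cS->.
  exact: Ss.
have ex (k : 'I_(size s)) : exists e, [/\ e \in S, g e = i & p e = s`_k].
  by apply: sS; rewrite mem_nth// ltn_ord.
have [h hP] := choice ex; exists (fun e => \sum_k w k * (e == h k)%:R); split.
- by move=> e; apply: sumr_ge0 => k _; rewrite mulr_ge0.
- move=> e eN; apply: big1 => k _; case: eqP => [ek|_]; last by rewrite mulr0.
  by have [hS gh _] := hP k; rewrite ek hS gh eqxx in eN.
- rewrite exchange_big/= -[RHS]w1; apply: eq_bigr => k _.
  by rewrite -mulr_sumr (bigD1 (h k))//= eqxx big1 ?addr0 ?mulr1// => e /negPf->.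
- under [RHS]eq_bigr do rewrite scaler_suml.
  rewrite exchange_big/=; apply: eq_bigr => k _.
  rewrite (bigD1 (h k))//= eqxx mulr1 big1 ?addr0; last first.
    by move=> e /negPf->; rewrite mulr0 scale0r.
  by have [_ _ ->] := hP k.
Qed.

(** * The criterion *)

Section Rado.
Variables (F : fieldType) (m n : nat) (E : finType) (g : E -> 'I_m) (v : E -> 'rV[F]_n).

Let sp (S : {set E}) (I : {set 'I_m}) : 'M[F]_n :=
  (\sum_(e | (e \in S) && (g e \in I)) <<v e>>)%MS.

Let sp_sup (S : {set E}) (I : {set 'I_m}) e : e \in S -> g e \in I -> (v e <= sp S I)%MS.
Proof. by move=> eS gI; apply: (sumsmx_sup e); rewrite ?eS ?gI ?genmxE. Qed.

Let sp_subP k (S : {set E}) (I : {set 'I_m}) (A : 'M[F]_(k, n)) :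
  (forall e, e \in S -> g e \in I -> (v e <= A)%MS) -> (sp S I <= A)%MS.
Proof. by move=> SA; apply/sumsmx_subP => e /andP[eS gI]; rewrite genmxE SA. Qed.

(* Rado's theorem, by deleting elements: if deleting either of two elements of
   the same colour breaks Hall's condition, submodularity of the rank gives a
   contradiction. *)
Lemma rado (S : {set E}) : (forall I : {set 'I_m}, #|I| <= \rank
    (\sum_(e | (e \in S) && (g e \in I)) <<v e>>)%MS)%N ->
  exists2 h : 'I_m -> E, (forall i, h i \in S /\ g (h i) = i) &
    row_free (\matrix_i v (h i)).
Proof.
have [N] := ubnP #|S|; elim: N S => // N IHN S; rewrite ltnS => SN hall.
have [[e [e' [eS e'S ee' gee']]]|single] := pselect (exists e e',
    [/\ e \in S, e' \in S, e != e' & g e = g e']); last first.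
  have ex i : exists e, e \in S /\ g e = i.
    apply: contrapT => Ne; have := hall [set i]%SET; rewrite cards1 big_pred0.
      by rewrite mxrank0.
    move=> e; apply/negbTE/negP => /andP[eS]; rewrite inE => /eqP gi.
    by apply: Ne; exists e.
  have [h hP] := choice ex; exists h => //.
  have hg e : e \in S -> h (g e) = e.
    move=> eS; apply: contrapT => /eqP he; apply: single; exists (h (g e)), e.
    by have [hS gh] := hP (g e).
  rewrite /row_free eqn_leq rank_leq_row/=.
  have := hall finset.setT; rewrite cardsT card_ord => /leq_trans; apply.
  apply: mxrankS; apply: sp_subP => e eS _.
  have := row_sub (g e) (\matrix_i v (h i)).
  by rewrite rowK hg.
have minus d : d \in S -> (forall I : {set 'I_m}, #|I| <= \rank (sp (S :\ d) I))%N ->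
    exists2 h : 'I_m -> E, (forall i, h i \in S /\ g (h i) = i) &
      row_free (\matrix_i v (h i)).
  move=> dS hd; have [|h hP fr] := IHN (S :\ d) _ hd.
    by apply: leq_trans SN; rewrite (cardsD1 d S) dS.
  by exists h => // i; have [] := hP i; rewrite inE => /andP[].
apply: contrapT => Nh.
have viol d : d \in S -> exists I : {set 'I_m}, (\rank (sp (S :\ d) I) < #|I|)%N.
  move=> dS; apply: contrapT => NI; apply: Nh; apply: (minus d) => // I.
  by rewrite leqNgt; apply/negP => ltI; apply: NI; exists I.
have [I rI] := viol e eS; have [J rJ] := viol e' e'S.
have color d (K : {set 'I_m}) : (\rank (sp (S :\ d) K) < #|K|)%N -> g d \in K.
  move=> rK; apply: contraLR rK => gK; rewrite -leqNgt.
  apply: leq_trans (hall K) _; apply: mxrankS; apply: sp_subP => f fS gf.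
  apply: sp_sup => //; rewrite !inE fS andbT.
  by apply: contraNneq gK => <-.
have gI := color _ _ rI; have gJ := color _ _ rJ; rewrite -gee' in gJ.
(* The two ranks add up to at most [|I| + |J| - 2]. The sum of the spans has rank at least
   [|I :|: J|], because an element deleted from one span is present in the other; their intersection
   has rank at least [|I :&: J| - 1], by dropping the common colour of [e] and [e']. *)
have := mxrank_sum_cap (sp (S :\ e) I) (sp (S :\ e') J).
have geU : (#|I :|: J| <= \rank (sp (S :\ e) I + sp (S :\ e') J)%MS)%N.
  apply: leq_trans (hall _) _; apply: mxrankS; apply: sp_subP => f fS gf.
  have fI : g f \in I -> f != e -> (v f <= sp (S :\ e) I + sp (S :\ e') J)%MS.
    move=> fI fe; apply: submx_trans (addsmxSl _ _); apply: sp_sup => //.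
    by rewrite !inE fe.
  have fJ : g f \in J -> f != e' -> (v f <= sp (S :\ e) I + sp (S :\ e') J)%MS.
    move=> fJ fe'; apply: submx_trans (addsmxSr _ _); apply: sp_sup => //.
    by rewrite !inE fe'.
  have [fe|fe] := eqVneq f e; first by apply: fJ; rewrite fe.
  have [fe'|fe'] := eqVneq f e'; first by apply: fI; rewrite // fe' -gee'.
  by case/setUP: gf => [/fI|/fJ]; apply.
have geI : (#|I :&: J| <= (\rank (sp (S :\ e) I :&: sp (S :\ e') J)%MS).+1)%N.
  have gIJ : g e \in (I :&: J)%SET by rewrite inE gI.
  rewrite (cardsD1 (g e)) gIJ add1n ltnS.
  apply: leq_trans (hall _) _; apply: mxrankS; apply: sp_subP => f fS.
  rewrite !inE => /and3P[gfe gfI gfJ].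
  have fe : f != e by apply: contraNneq gfe => ->.
  have fe' : f != e' by apply: contraNneq gfe => ->; rewrite gee'.
  by rewrite sub_capmx !sp_sup// !inE ?fe ?fe'.
have := cardsUI I J; move: rI rJ geU geI; rewrite -!/(sp _ _).
set a := \rank _; set b := \rank _; set c := \rank _; set d := \rank _.
move: a b c d #|I| #|J| => a b c d x y; clear; lia.
Qed.

End Rado.

Section Essential.
Variables (R : realType) (n : nat).
Local Notation vec := 'rV[R]_n.

(** Replacing a single [a i] by [b i] in the sum of the [a i] moves it by [b i - a i], which gives
    the affinely independent points. *)
Lemma segments_essential (K : 'I_n -> set vec) (a b : 'I_n -> vec) :
  (forall i, K i (a i)) -> (forall i, K i (b i)) ->
  row_free (\matrix_i (b i - a i)) -> essential K.
Proof.
move=> Ka Kb fr I _; pose q (k : 'I_#|I|) : 'I_n := enum_val k.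
have sumI (y : 'I_n -> vec) k : \sum_(i in I) y i + (b (q k) - a (q k)) =
    \sum_(i in I) (if i == q k then y i + (b (q k) - a (q k)) else y i).
  rewrite (bigD1 (q k)) ?enum_valP//= [RHS](bigD1 (q k)) ?enum_valP//= eqxx addrAC.
  by congr (_ + _); apply: eq_bigr => i /andP[_ /negPf->].
exists (\sum_(i in I) a i); split; first by exists a.
exists (fun k => b (q k) - a (q k)); split=> [k|].
  rewrite sumI; eexists; split; last by reflexivity.
  by move=> i _ /=; case: eqP => [->|_//]; rewrite addrC subrK.
apply: inj_row_free => y yM.
pose z : 'rV[R]_n := \row_i \sum_(k | q k == i) y 0 k.
have zM : z *m \matrix_i (b i - a i) = 0.
  move: yM; rewrite !mulmx_sum_row => yM; rewrite -[RHS]yM [RHS](partition_big q xpredT)//=.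
  apply: eq_bigr => i _; rewrite mxE rowK scaler_suml.
  by apply: eq_bigr => k /eqP <-; rewrite rowK.
have /rowP z0 : z = 0.
  by case/row_freeP: fr => B MB; rewrite -[z]mulmx1 -MB mulmxA zM mul0mx.
apply/rowP => k; have := z0 (q k); rewrite !mxE (bigD1 k)//= big1 ?addr0//.
by move=> j /andP[/eqP/enum_val_inj-> /eqP].
Qed.

End Essential.

Section PointConfiguration.
Variables (R : realType) (n' : nat).
Local Notation n := n'.+1.
Local Notation vec := 'rV[R]_n.
Variable L : 'I_n -> seq vec.
Hypothesis L0 : forall i, L i != [::].

Definition pt_size := \max_(i < n) size (L i).
Definition pt_index := ('I_n * 'I_pt_size)%type.
(** Lists are padded to a common length by repeating their heads, so that padding adds no new point.
    A point may thus have several indices. *)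
Definition pt (e : pt_index) : vec := nth (head 0 (L e.1)) (L e.1) e.2.
Definition pt_color (e : pt_index) : 'I_n := e.1.

Lemma pt_in (e : pt_index) : pt e \in L (pt_color e).
Proof.
rewrite /pt /pt_color; have [lt_e|le_e] := ltnP e.2 (size (L e.1)).
  by rewrite mem_nth.
by rewrite nth_default//; case: (L e.1) (L0 e.1) => // x s _; rewrite inE eqxx.
Qed.

Lemma pt_ex i x : x \in L i -> exists e, pt_color e = i /\ pt e = x.
Proof.
move=> xL; have k : (index x (L i) < pt_size)%N.
  by apply: leq_trans (leq_bigmax i); rewrite index_mem.
by exists (i, Ordinal k); split => //; rewrite /pt nth_index.
Qed.

Lemma hull_pt (S : {set pt_index}) (i : 'I_n) (s : seq vec) :
  (forall e, e \in S -> pt_color e = i -> conv s (pt e)) ->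
  (forall x, x \in s -> x \in L i) ->
  (forall e, pt_color e = i -> pt e \in s -> e \in S) ->
  hull pt_color pt S i = conv s.
Proof.
move=> Ss sL sS; apply: hull_conv => // x xs.
by have [e [ge pe]] := pt_ex (sL x xs); exists e; split => //; apply: sS; rewrite ?pe.
Qed.

Lemma full_pt (S : {set pt_index}) (s : 'I_n -> seq vec) :
  (forall i, s i != [::]) -> (forall i x, x \in s i -> x \in L i) ->
  (forall e, pt e \in s (pt_color e) -> e \in S) -> full pt_color S.
Proof.
move=> s0 sL sS i.
have [x xs] : exists x, x \in s i.
  by case: (s i) (s0 i) => // x r _; exists x; rewrite inE eqxx.
by have [e [ge pe]] := pt_ex (sL i x xs); exists e => //; apply: sS; rewrite ge pe.
Qed.

End PointConfiguration.

Section Criterion.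
Variables (R : realType) (n' : nat).
Local Notation n := n'.+1.
Local Notation vec := 'rV[R]_n.
Variables (P Q : 'I_n -> set vec) (s t : 'I_n -> seq vec).
Hypotheses (s0 : forall i, s i != [::]) (t0 : forall i, t i != [::]).
Hypotheses (Ps : forall i, P i = conv (s i)) (Qt : forall i, Q i = conv (t i)).
Hypothesis PQ : forall i, P i `<=` Q i.

Let faces (u : vec) (i : 'I_n) : set vec :=
  if i \in Tu P Q u then face (Q i) u else Q i.

Lemma criterion_necessary : mixed_volume P < mixed_volume Q ->
  exists u, unit_sphere u /\ essential (faces u).
Proof.
pose L i := s i ++ t i.
have L0 i : L i != [::] by rewrite /L; case: (s i) (s0 i).
have sL i x : x \in s i -> x \in L i by rewrite mem_cat => ->.
have tL i x : x \in t i -> x \in L i by rewrite mem_cat orbC => ->.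
have ptQ e : Q (pt_color e) (pt (L := L) e).
  have := pt_in L0 e; rewrite mem_cat => /orP[es|et].
    by apply: PQ; rewrite Ps; exact: conv_mem.
  by rewrite Qt; exact: conv_mem.
pose SP : {set pt_index L} := [set e | pt e \in s (pt_color e)]%SET.
have fSP : full (@pt_color _ _ L) SP.
  by apply: (full_pt s0 sL) => e; rewrite inE.
have hullP i : P i = hull (@pt_color _ _ L) (@pt _ _ L) SP i.
  rewrite Ps; apply/esym/hull_pt.
  - by move=> e + <-; rewrite inE => /conv_mem.
  - exact: sL.
  - by move=> e ge; rewrite inE ge.
have hullQ i : Q i = hull (@pt_color _ _ L) (@pt _ _ L) finset.setT i.
  rewrite Qt; apply/esym/hull_pt; [|exact: tL|by move=> *; rewrite inE].
  by move=> e _ <-; rewrite -Qt.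
have fT : full (@pt_color _ _ L) finset.setT by apply: full_sub fSP; exact: finset.subsetT.
rewrite (mixed_volume_hull fSP hullP) (mixed_volume_hull fT hullQ) => ltPQ.
pose om (e : pt_index L) : R := if e \in SP then 0 else -1.
have tight_om0 : tight (@pt_color _ _ L) (@pt _ _ L) finset.setT om 0 = SP.
  apply: tight0 => //.
    by move=> e; rewrite /om => ->.
  by move=> e _ /negPf eS; rewrite /om eS oppr_lt0.
have [w [wP w_gt0]] : exists w, tight (@pt_color _ _ L) (@pt _ _ L) finset.setT om w != SP /\
    0 < cayley_mv (@pt_color _ _ L) (@pt _ _ L) (tight (@pt_color _ _ L) (@pt _ _ L) finset.setT om w).
  apply: contrapT => Nw; move: ltPQ; rewrite (cayley_mv_cells _ om fT) ltNge => /negP; apply.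
  rewrite (bigD1 SP)/=; last by apply/asboolP; exists 0; rewrite tight_om0.
  rewrite gerDl sumr_le0// => T /andP[/asboolP[w ->] wP].
  by rewrite leNgt; apply/negP => w_gt0; apply: Nw; exists w.
have [a [b [abT fr]]] := cayley_mv_gt0_transversal (tight_full _ om w fT) w_gt0.
have w0 : w != 0 by apply: contra_neq wP => ->.
have ww := inner_gt0 w0.
pose r := Num.sqrt (inner w w).
have r0 : 0 < r by rewrite sqrtr_gt0.
exists (r^-1 *: w); split.
  rewrite /unit_sphere/= innerZl innerZr mulrA -invfM -expr2 sqr_sqrtr ?inner_ge0//.
  by rewrite mulVf// gt_eqF.
have facesT e : e \in tight (@pt_color _ _ L) (@pt _ _ L) finset.setT om w ->
    faces (r^-1 *: w) (pt_color e) (pt e).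
  move=> eT; rewrite /faces; case: ifPn => [|_]; last exact: ptQ.
  rewrite /Tu inE => /asboolP[x [Px [Qx xmax]]].
  (* [P_i] reaches the hyperplane supporting [Q_i], hence so does one of its generators [z], which
     has height 0. A tight point has height at most 0 and a lifted value no less than that of [z],
     so it lies on this hyperplane too. *)
  have [z zs zmax] := conv_max w (s0 (pt_color e)).
  have xz : inner w x <= inner w z by apply: zmax; rewrite -Ps.
  have [e' [ge' pe']] := pt_ex (sL _ _ zs).
  have e'SP : e' \in SP by rewrite inE ge' pe'.
  split=> // y Qy; rewrite !innerZl ler_pM2l ?invr_gt0//.
  have yx : inner w y <= inner w x.
    by have := xmax y Qy; rewrite !innerZl ler_pM2l ?invr_gt0.
  move: eT; rewrite inE => /andP[_ /forallP/(_ e')]; rewrite inE ge' eqxx/=.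
  rewrite /lifted pe' {1}/om e'SP addr0 => ze.
  have : om e <= 0 by rewrite /om; case: ifP => // _; rewrite oppr_le0.
  by move: yx xz ze; lra.
apply: (@segments_essential _ _ _ (fun i => pt (a i)) (fun i => pt (b i))) => //.
  by move=> i; have [aT _ ga _] := abT i; have := facesT _ aT; rewrite ga.
by move=> i; have [_ bT _ gb] := abT i; have := facesT _ bT; rewrite gb.
Qed.

(** Rado's theorem is applied to the differences between generators in [faces u i] and a base point
    [a i]. They span all differences of points of a partial sum, so essentiality is Hall's
    condition. The base points maximise [u] on [Q_i] for every [i], which puts them strictly above
    [P_i] when [i] is outside [Tu]. *)
Lemma essential_segments (u : vec) : essential (faces u) ->
  exists a b : 'I_n -> vec, [/\ forall i, face (Q i) u (a i), forall i, faces u i (b i) &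
    row_free (\matrix_i (b i - a i))].
Proof.
move=> ess.
have tQ i x : x \in t i -> Q i x by rewrite Qt; exact: conv_mem.
have top i : exists x, x \in t i /\ forall y, Q i y -> inner u y <= inner u x.
  by have [x xt xmax] := conv_max u (t0 i); exists x; rewrite Qt.
have [a aP] := choice top; have at_ i := (aP i).1; have amax i := (aP i).2.
have fa i : face (Q i) u (a i) by split; [exact: tQ|exact: amax].
pose S : {set pt_index t} := [set e | `[< faces u (pt_color e) (pt e) >]]%SET.
have facesS i y : faces u i y -> hull (@pt_color _ _ t) (@pt _ _ t) S i y.
  have hullQ : Q i = hull (@pt_color _ _ t) (@pt _ _ t) finset.setT i.
    rewrite Qt; apply/esym/hull_pt => //; last by move=> *; rewrite inE.
    by move=> e _ <-; apply: conv_mem; exact: pt_in.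
  have facesQ : faces u i y -> Q i y by rewrite /faces; case: ifP => // _ [].
  move=> fy; have := facesQ fy; rewrite {1}hullQ => -[c [c0 cT c1 yE]].
  exists c; split => // e; apply: contraNeq => ce.
  have ge : pt_color e = i by apply/eqP; apply: contraNT ce => ge; rewrite cT// (negPf ge) andbF.
  rewrite ge eqxx andbT inE; apply/asboolP; rewrite /faces ge.
  have Qe : Q i (pt e) by rewrite -ge; apply: tQ; exact: pt_in.
  case: ifPn => // iT; split => // z Qz.
  apply: le_trans (amax i _ Qz) _.
  have yai : inner u (a i) <= inner u y by move: fy; rewrite /faces iT => -[_]; apply; exact: tQ.
  (* A convex combination attaining the maximum of [u] involves only points attaining it: all terms
     are nonnegative and sum to 0. *)
  have sum0 : \sum_e c e * (inner u (a i) - inner u (pt e)) = 0.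
    have -> : \sum_e c e * (inner u (a i) - inner u (pt e)) = inner u (a i) - inner u y.
      under eq_bigr do rewrite mulrBr; rewrite sumrB -mulr_suml c1 mul1r yE inner_sumr.
      by congr (_ - _); apply: eq_bigr => f _; rewrite innerZr.
    by apply/eqP; rewrite subr_eq0 eq_le yai amax//; exact: facesQ.
  have := psumr_eq0P _ sum0 (i := e) isT; move=> /(_ _)/eqP; rewrite mulf_eq0 (negPf ce)/=.
  rewrite subr_eq0 => /(_ _)/eqP -> // f _.
  have [->|cf] := eqVneq (c f) 0; first by rewrite mul0r.
  rewrite mulr_ge0// subr_ge0 amax//.
  have /eqP <- : pt_color f == i by apply: contraNT cf => gf; rewrite cT// (negPf gf) andbF.
  by apply: tQ; exact: pt_in.
have fai i : faces u i (a i) by rewrite /faces; case: ifP => _; [exact: fa|exact: tQ].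
have [|h hP fr] := @rado R n n (pt_index t) (@pt_color _ _ t)
  (fun e => pt e - a (pt_color e)) S; last first.
  exists a, (fun i => pt (h i)); split => // [i|].
    by have [+ gh] := hP i; rewrite inE gh => /asboolP.
  move: fr; congr row_free; apply/matrixP => i j.
  by rewrite !mxE (hP i).2.
move=> I; set A := (\sum_(_ | _) _)%MS.
have [|x [[y [yK xE]] [v [vK fr]]]] := ess I; first by rewrite -[leqRHS]card_ord max_card.
have dirA z : Defs.msum I (faces u) z -> (z - \sum_(i in I) a i <= A)%MS.
  move=> [k [kK ->]]; rewrite -sumrB; apply: summx_sub => i iI.
  have [c [c0 cS c1 kE]] := facesS _ _ (kK i iI).
  have -> : k i - a i = \sum_e c e *: (pt e - a i).
    by under eq_bigr do rewrite scalerBr; rewrite sumrB -scaler_suml c1 scale1r -kE.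
  apply: summx_sub => e _; have [->|ce] := eqVneq (c e) 0; first by rewrite scale0r sub0mx.
  have /andP[eS /eqP ge] : (e \in S) && (pt_color e == i) by apply: contraNT ce => /cS->.
  apply: scalemx_sub; rewrite -ge; apply: (sumsmx_sup e); first by rewrite eS ge iI.
  by rewrite genmxE.
have <- : \rank (\matrix_i v i) = #|I| by apply/eqP.
apply: mxrankS; apply/row_subP => k; rewrite rowK.
have -> : v k = (x + v k - \sum_(i in I) a i) - (x - \sum_(i in I) a i).
  by rewrite opprB addrA subrK addrC addKr.
by apply: addmx_sub; [apply: dirA|rewrite -scaleN1r; apply/scalemx_sub/dirA; exists y].
Qed.

Lemma criterion_sufficient (u : vec) : unit_sphere u -> essential (faces u) ->
  mixed_volume P < mixed_volume Q.
Proof.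
move=> u1 /essential_segments[a [b [fa fb fr]]].
have u0 : u != 0.
  by apply/eqP => uE; move: u1; rewrite /unit_sphere/= uE inner0l => /eqP; rewrite eq_sym oner_eq0.
have topP i : exists x, x \in s i /\ forall y, P i y -> inner u y <= inner u x.
  by have [x xs xmax] := conv_max u (s0 i); exists x; rewrite Ps.
have [x xP] := choice topP; pose m i := inner u (x i).
have mP i y : P i y -> inner u y <= m i by exact: (xP i).2.
have Px i : P i (x i) by rewrite Ps; apply: conv_mem; exact: (xP i).1.
have gap i : i \notin Tu P Q u -> m i < inner u (a i).
  apply: contraNT; rewrite -leNgt => am; rewrite inE; apply/asboolP.
  exists (x i); split => //; split; first exact: PQ.
  by move=> y /(fa i).2 /le_trans; apply.
(* The fraction is chosen so that [dl <= d i] implies that [dl] times the absolute value of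
   [inner u (b i - a i)] is less than the gap [inner u (a i) - m i]; then [b' i] stays strictly
   above [P_i]. *)
pose d i := if i \in Tu P Q u then 1 else
  (inner u (a i) - m i) / (inner u (a i) - m i + 1 + `|inner u (b i - a i)|).
have d01 i : 0 < d i <= 1.
  rewrite /d; case: ifPn => [_|/gap]; first by rewrite ltr01 lexx.
  rewrite -subr_gt0 => gi; have ni := normr_ge0 (inner u (b i - a i)).
  have di : 0 < inner u (a i) - m i + 1 + `|inner u (b i - a i)| by lra.
  by rewrite divr_gt0//= ler_pdivrMr// mul1r; lra.
(* A product of numbers in []0, 1]] is at most each of them. One common factor scales the whole
   matrix of directions, which preserves its rank. *)
pose dl := \prod_i d i.
have dl_gt0 : 0 < dl by apply: prodr_gt0 => i _; case/andP: (d01 i).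
have dl_le i : dl <= d i.
  rewrite /dl (bigD1 i)//= ler_piMr//; first by case/andP: (d01 i) => /ltW.
  by apply: prodr_ile1 => j _; case/andP: (d01 j) => /ltW-> ->.
have dl1 : dl <= 1 by apply: le_trans (dl_le ord0) _; case/andP: (d01 ord0).
pose b' i := a i + dl *: (b i - a i).
have Qa i : Q i (a i) by case: (fa i).
have Qb i : Q i (b i) by have := fb i; rewrite /faces; case: ifP => // _ [].
have Qb' i : Q i (b' i) by rewrite Qt; apply: conv_seg; rewrite -?Qt// ltW.
have b'T i : i \in Tu P Q u -> inner u (b' i) = inner u (a i).
  move=> iT; have := fb i; rewrite /faces iT => -[_ bmax].
  rewrite /b' innerDr innerZr innerBr.
  have /eqP -> : inner u (b i) == inner u (a i) by rewrite eq_le bmax// (fa i).2.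
  by rewrite subrr mulr0 addr0.
have b'm i : i \notin Tu P Q u -> m i < inner u (b' i).
  move=> iT; rewrite /b' innerDr innerZr.
  have := dl_le i; rewrite /d (negPf iT); have := gap _ iT.
  move: (inner u (b i - a i)) => c gi.
  have nc := normr_ge0 c; have di : 0 < inner u (a i) - m i + 1 + `|c| by lra.
  rewrite ler_pdivlMr// => dlc.
  have : dl * `|c| < inner u (a i) - m i by nra.
  have : - (dl * `|c|) <= dl * c by rewrite -mulrN ler_pM2l// lerNl -normrN ler_norm.
  by lra.
have fr' : row_free (\matrix_i (b' i - a i)).
  have -> : \matrix_i (b' i - a i) = dl *: \matrix_i (b i - a i).
    by apply/row_matrixP => i; rewrite linearZ/= !rowK /b' addrC addKr.
  by rewrite /row_free mxrank_scale_nz // gt_eqF.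
pose L i := [:: a i; b' i] ++ s i ++ t i.
have L0 i : L i != [::] by [].
pose C := @pt_color _ _ L; pose p := @pt _ _ L.
have sL i y : y \in s i -> y \in L i by rewrite !mem_cat => ->; rewrite orbT.
have tL i y : y \in t i -> y \in L i by rewrite !mem_cat => ->; rewrite !orbT.
have ptQ e : Q (C e) (p e).
  have := pt_in L0 e; rewrite -/(p e) -/(C e) !mem_cat !inE -orbA => /or4P[/eqP->//|/eqP->//|es|et].
    by apply: PQ; rewrite Ps; exact: conv_mem.
  by rewrite Qt; exact: conv_mem.
pose SP : {set pt_index L} := [set e | p e \in s (C e)]%SET.
pose ab (e : pt_index L) := p e \in [:: a (C e); b' (C e)].
(* The hulls increase from [SP] through [S1] and [S2] to the whole; the outer comparisons are
   monotonicity, and strictness is gained between [S1] and [S2]. Segments of colours in [Tu] already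
   belong to [S1]: they lie on the supporting hyperplane of [Q_i], so they are maximal for [u] at
   height 0. *)
pose S1 : {set pt_index L} :=
  [set e | (p e \in s (C e)) || (C e \in Tu P Q u) && ab e]%SET.
pose S2 : {set pt_index L} := [set e | (p e \in s (C e)) || ab e]%SET.
have fSP : full C SP by apply: (full_pt s0 sL) => e; rewrite inE.
have hullP i : P i = hull C p SP i.
  rewrite Ps; apply/esym/hull_pt.
  - by move=> e + <-; rewrite inE => /conv_mem.
  - exact: sL.
  - by move=> e ge; rewrite inE /C ge.
have hullQ i : Q i = hull C p finset.setT i.
  rewrite Qt; apply/esym/hull_pt; [|exact: tL|by move=> *; rewrite inE].
  by move=> e _ <-; rewrite -Qt; exact: ptQ.
have SP1 : SP \subset S1 by apply/fintype.subsetP => e; rewrite !inE => ->.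
have S12 : S1 \subset S2.
  by apply/fintype.subsetP => e; rewrite !inE => /orP[->//|/andP[_ ->]]; rewrite orbT.
have fS1 := full_sub SP1 fSP; have fS2 := full_sub S12 fS1.
have fT := full_sub (finset.subsetT S2) fS2.
rewrite (mixed_volume_hull fSP hullP) (mixed_volume_hull fT hullQ).
apply: le_lt_trans (le_cayley_mv p SP1 fSP) _.
apply: lt_le_trans (le_cayley_mv p (finset.subsetT S2) fS2).
(* On [S2] outside [S1] this height is negative, which keeps [S1] the cell of 0, and it brings the
   lifted value at [u] to exactly [m (C e)], the maximum of [u] on the corresponding [P_i]. *)
pose om (e : pt_index L) : R := if e \in S1 then 0 else m (C e) - inner u (p e).
have S1m e : e \in S1 -> C e \notin Tu P Q u -> inner u (p e) <= m (C e).
  rewrite inE => /orP[es _|/andP[-> //]]; apply: mP.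
  by rewrite Ps; exact: conv_mem.
have abm e : ab e -> C e \notin Tu P Q u -> m (C e) < inner u (p e).
  by move=> abe eT; move: abe; rewrite /ab !inE => /orP[] /eqP->; [exact: gap|exact: b'm].
have S21 e : e \in S2 -> e \notin S1 -> ab e /\ C e \notin Tu P Q u.
  rewrite !inE negb_or negb_and => /orP[->//|abe /andP[_]]; rewrite abe orbF.
  by [].
have tight_om0 : tight C p S2 om 0 = S1.
  apply: tight0 => //; first by move=> e; rewrite /om => ->.
  move=> e eS2 eS1; rewrite /om (negPf eS1) subr_lt0.
  by have [abe eT] := S21 _ eS2 eS1; exact: abm.
have tight_ab e : ab e -> e \in tight C p S2 om u.
  move=> abe; rewrite inE; apply/andP; split; first by rewrite inE abe orbT.
  apply/forallP => e'; apply/implyP => e'S2; apply/implyP => /eqP gee'.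
  have [eT|eT] := boolP (C e \in Tu P Q u).
    have eS1 : e \in S1 by rewrite inE eT abe orbT.
    have e'S1 : e' \in S1.
      by apply: contraLR eT => /(S21 _ e'S2)[_]; rewrite gee'.
    rewrite /lifted /om eS1 e'S1 !addr0.
    have -> : inner u (p e) = inner u (a (C e)).
      by move: abe; rewrite /ab !inE => /orP[]/eqP->//; exact: b'T.
    by apply: (fa (C e)).2; rewrite -gee'; exact: ptQ.
  have eS1 : e \notin S1.
    by apply/negP => /S1m/(_ eT); rewrite leNgt abm.
  rewrite /lifted {2}/om (negPf eS1) addrC -[leRHS]addrC subrK /om -gee'.
  case: ifPn => [e'S1|_]; last by rewrite subrK.
  by rewrite add0r S1m// gee'.
have [ea eaP] : exists ea : 'I_n -> pt_index L, forall i, C (ea i) = i /\ p (ea i) = a i.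
  have ex i : exists e : pt_index L, C e = i /\ p e = a i.
    by apply: pt_ex; rewrite inE eqxx.
  by have [ea eaP] := choice ex; exists ea.
have [eb ebP] : exists eb : 'I_n -> pt_index L, forall i, C (eb i) = i /\ p (eb i) = b' i.
  have ex i : exists e : pt_index L, C e = i /\ p e = b' i.
    by apply: pt_ex; rewrite !inE eqxx orbT.
  by have [eb ebP] := choice ex; exists eb.
have ab_ea i : ab (ea i) by rewrite /ab (eaP i).1 (eaP i).2 inE eqxx.
have ab_eb i : ab (eb i) by rewrite /ab (ebP i).1 (ebP i).2 !inE eqxx orbT.
have tr : transversal C p (tight C p S2 om u).
  exists ea, eb; split.
    by move=> i; split; [exact: tight_ab|exact: tight_ab|exact: (eaP i).1|exact: (ebP i).1].
  move: fr'; congr row_free; apply/row_matrixP => i.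
  by rewrite !rowK (eaP i).2 (ebP i).2.
(* Otherwise all [n] independent directions [b' i - a i] would be orthogonal to [u]. Such an [i] is
   what distinguishes the two cells. *)
have [i iT] : exists i, i \notin Tu P Q u.
  apply: contrapT => NT; have allT i : i \in Tu P Q u.
    by apply: contraT => iT; case: NT; exists i.
  have uM : \matrix_i (b' i - a i) *m u^T = 0.
    apply/matrixP => i j; rewrite !mxE -[RHS](subrr (inner u (a i))) -{1}(b'T i)//.
    by rewrite -innerBr innerC; apply: eq_bigr => k _; rewrite !mxE ord1.
  move: u0; rewrite -trmx_eq0 => /eqP[].
  move: fr'; rewrite row_free_unit => uMx.
  by rewrite -(mulKmx uMx u^T) uM mulmx0.
have neq : tight C p S2 om 0 != tight C p S2 om u.
  rewrite tight_om0; apply/eqP => S1u.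
  have := tight_ab _ (ab_ea i); rewrite -S1u => /S1m; rewrite (eaP i).1 => /(_ iT).
  by rewrite leNgt (eaP i).2 gap.
have := cayley_mv_tight fS2 neq; rewrite tight_om0; apply: lt_le_trans.
by rewrite ltrDl; exact: transversal_cayley_mv_gt0.
Qed.

End Criterion.

Theorem theorem3p3 (R : realType) (n : nat) (P Q : 'I_n -> set 'rV[R]_n) :
  (forall i, polytope (P i)) -> (forall i, polytope (Q i)) ->
  (forall i, P i `<=` Q i) ->
  (mixed_volume P < mixed_volume Q <->
   exists u : 'rV[R]_n, unit_sphere u /\
     essential (fun i => if i \in Tu P Q u then face (Q i) u else Q i)).
Proof.
case: n P Q => [|n'] P Q polyP polyQ PQ.
  (* In dimension 0 both sides are false: the families are empty, hence equal, and there is no unit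
     vector. *)
  have -> : P = Q by apply/funext; case.
  rewrite ltxx; split => // -[u [+ _]].
  by rewrite /unit_sphere/= /inner big_ord0 => /esym/eqP; rewrite oner_eq0.
have [s sP] := choice polyP; have [t tP] := choice polyQ.
have s0 i := (sP i).1; have t0 i := (tP i).1.
have Ps i := (sP i).2; have Qt i := (tP i).2.
split; first exact: (criterion_necessary s0 Ps Qt PQ).
by move=> [u [u1 ess]]; exact: (criterion_sufficient s0 t0 Ps Qt PQ u1 ess).
Qed.
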